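(* Let $d\ge2$, $\alpha>0$, $\omega^*=\frac1{1+\alpha}$, and for $0<\omega<\omega^*$ let $\varphi_\omega$ be the positive solution of $$-\omega \varphi=-\nabla\cdot\left(\frac{\nabla\varphi}{1-|\varphi|^{2\alpha}}\right)+\alpha|\varphi|^{2\alpha-2}\frac{|\nabla\varphi|^2}{(1-|\varphi|^{2\alpha})^2}\varphi-|\varphi|^{2\alpha}\varphi\qquad\text{in }\mathbb{R}^d .$$ Then $\lim_{\omega\to\omega^*}\|\varphi_\omega-1\|_{L^\infty_{\mathrm{loc}}}=0$, i.e. $\varphi_\omega\to1$ uniformly on every compact subset of $\mathbb{R}^d$ as $\omega\to\omega^*$, $\omega<\omega^*$. Moreover there is a constant $K$ depending on $\alpha$ and $d$ such that, as $\omega\to\omega^*$, $\omega<\omega^*$, $$M(\omega)=\|\varphi_\omega\|_{L^2(\mathbb{R}^d)}^2=\frac{K}{(\omega^*-\omega)^d}+o\Big(\frac1{(\omega^*-\omega)^d}\Big).$$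
   Context: For $0<\omega<\frac{1}{1+\alpha}$ the equation has, up to translations, a unique solution in $H^1(\mathbb{R}^d)$ with $0<\varphi<1$ and $\varphi(x)\to0$ as $|x|\to\infty$, and it is radially decreasing about some point; $\varphi_\omega$ denotes this solution, translated so as to be radial about the origin. *)

(* Defs.v *)
From HB Require Import structures.
From mathcomp Require Import all_boot all_order all_algebra.
From mathcomp Require Import all_classical all_reals all_analysis.

Set Implicit Arguments.
Unset Strict Implicit.
Unset Printing Implicit Defensive.

Import Order.TTheory GRing.Theory Num.Theory.
Import numFieldNormedType.Exports.

Local Open Scope classical_set_scope.
Local Open Scope ring_scope.

(* Functions on R^d have domain 'rV[R]_d, where the library provides topology
   and derivatives; measurable sets live on d.-tuple R, which carries the
   product sigma-algebra. The two are identified by row_of_tuple. *)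

Section Lebesgue.
Variable R : realType.

Definition tuple_cons n (p : R * n.-tuple R) : n.+1.-tuple R :=
  [the n.+1.-tuple R of p.1 :: p.2].

Lemma measurable_tuple_cons n :
  measurable_fun [set: R * n.-tuple R] (@tuple_cons n).
Proof. exact: measurable_cons. Qed.

(* Pushing forward, rather than iterating integrals by hand, yields a bundled
   measure; \x^ is used because it only needs its left factor sigma-finite. *)
Fixpoint lebesgue_tuple n : {measure set (n.-tuple R) -> \bar R} :=
  match n with
  | 0 => dirac [tuple]
  | n'.+1 =>
      measure_function_pushforward__canonical__measure_function_Measure
        (product_measure2 (@lebesgue_measure R) (lebesgue_tuple n'))
        (@measurable_tuple_cons n')
  end.

Definition row_of_tuple d (t : d.-tuple R) : 'rV[R]_d := \row_i tnth t i.

Definition L2 d (f : 'rV[R]_d -> R) : Prop :=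
  f \o @row_of_tuple d \in Lfun (lebesgue_tuple d) 2%:E.

Definition L2norm d (f : 'rV[R]_d -> R) : R :=
  fine ('N[lebesgue_tuple d]_2%:E [EFin \o (f \o @row_of_tuple d)]).

End Lebesgue.

Section Calculus.
Variables (R : realType) (d : nat).
Implicit Types (f : 'rV[R]_d -> R) (x y : 'rV[R]_d).

(* The library norm on 'rV[R]_d is the sup norm. *)
Definition enorm x : R := Num.sqrt (\sum_i x ord0 i ^+ 2).

Definition partial (i : 'I_d) f : 'rV[R]_d -> R := 'D_(delta_mx ord0 i) f.

Definition grad_sqnorm f x : R := \sum_i partial i f x ^+ 2.

Definition divergence (V : 'I_d -> 'rV[R]_d -> R) x : R :=
  \sum_i partial i (V i) x.

Definition C1 f : Prop :=
  (forall x, differentiable f x) /\ (forall i, continuous (partial i f)).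

Definition C2 f : Prop := C1 f /\ (forall i, C1 (partial i f)).

(* Membership in the Sobolev space H^1 of a C1 function, whose weak gradient
   is its classical one. *)
Definition C1_in_H1 f : Prop := [/\ C1 f, L2 f & forall i, L2 (partial i f)].

Definition vanishes_at_infinity f : Prop :=
  forall e : R, 0 < e -> exists r : R, forall x, r < enorm x -> `|f x| < e.

(* Points of equal Euclidean norm are compared in both directions, so this
   includes radiality about the origin. *)
Definition radially_decreasing f : Prop :=
  forall x y, enorm x <= enorm y -> f y <= f x.

Definition omega_star (alpha : R) : R := 1 / (1 + alpha).

Definition solves (alpha omega : R) f : Prop :=
  forall x,
    - omega * f x =
      - divergence
          (fun i y => partial i f y / (1 - `|f y| `^ (2 * alpha))) x
      + alpha * `|f x| `^ (2 * alpha - 2)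
          * (grad_sqnorm f x / (1 - `|f x| `^ (2 * alpha)) ^+ 2) * f x
      - `|f x| `^ (2 * alpha) * f x.

(* The equation is uniformly elliptic with smooth coefficients wherever f is
   locally bounded away from 0 and 1, so the H^1 solution is a classical one. *)
Record positive_solution (alpha omega : R) f : Prop := PositiveSolution {
  solution_C2 : C2 f ;
  solution_H1 : C1_in_H1 f ;
  solution_gt0 : forall x, 0 < f x ;
  solution_lt1 : forall x, f x < 1 ;
  solution_vanishes : vanishes_at_infinity f ;
  solution_decreasing : radially_decreasing f ;
  solution_eq : solves alpha omega f
}.

End Calculus.

(* Main.v *)
Require Import Defs.
From HB Require Import structures.
From mathcomp Require Import all_boot all_order all_algebra.
From mathcomp Require Import all_classical all_reals all_analysis.
From mathcomp Require Import measurable_realfun ring lra.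

(* Let y = p^(2 alpha) for the radial profile p = p(r), and let
   q = - p' / (p (1 - y)) >= 0 and del = omega_star - omega. The equation becomes
     q' = (q^2 - omega_star) (1 - (1 + alpha) y) + del - (d - 1) q / r,
   and the energy p^2 H with H = (1 - y) (q^2 - omega_star) + del has derivative
   - 2 (d - 1) p^2 (1 - y) q^2 / r, hence decreases to 0 at infinity. At del = 0
   without the last term, q = sqrt omega_star is an exact solution: the front
   p' = - sqrt omega_star p (1 - p^(2 alpha)) joining 1 to 0. For small del > 0
   the profile stays exponentially close to 1 up to a radius r of order 1 / del
   and then follows this front. The energy inside is about del, and the loss
   across the front is 2 (d - 1) / r times the integral of sqrt omega_star p dp
   over [0, 1]; equating the two, del r tends to L = (d - 1) sqrt omega_star.
   Thus the mass is asymptotic to |B_1| (L / del)^d, i.e. K = |B_1| L^d. *)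

Set Implicit Arguments.
Unset Strict Implicit.
Unset Printing Implicit Defensive.

Import Order.TTheory GRing.Theory Num.Theory.
Import numFieldNormedType.Exports.

Local Open Scope classical_set_scope.
Local Open Scope ring_scope.

(** * Monotonicity on the real line *)

Section Calculus.
Variable R : realType.
Implicit Types f g D : R -> R.

(** All estimates are uniform over the profiles; no compactness and no convergence to the front is
    invoked. The mechanism is the identity [E' = (N * q / r) * (p ^+ 2)'] for [E = p ^+ 2 * H]: once
    [q] is pinched between multiples of [a = sqrt omega_star], [E] compares with constant multiples
    of [p ^+ 2], and this replaces the integral across the front. The lower bound on [q] comes from
    [H >= 0]. The upper bound is the obstacle. Where [1 - y] is bounded below, an excess of [q]
    would reinforce itself and blow up at a finite radius; where [y] is close to 1, the factor
    [1 - (1 + alpha) y] is negative and brakes [q]. The flatness of the core comes from a positive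
    lower bound on [q] for [r >= 1]: it makes [1 - y] grow exponentially in [r], so somewhat inside
    the front [(1 - y) * omega_star] is negligible against [del]. Outside the front, decay like
    [r ^- d] is enough, because square integrability is known beforehand: scaling by 2 then bounds
    the mass of the tail by that of a shell. *)

Lemma is_derive1_mul f g (x a b : R) :
  is_derive x 1 f a -> is_derive x 1 g b ->
  is_derive x 1 (fun z => f z * g z) (a * g x + f x * b).
Proof.
move=> fa gb; apply: (@is_derive_eq _ _ _ (f * g)).
by rewrite /GRing.scale /=; ring.
Qed.

Lemma is_derive1_sqr f (x a : R) :
  is_derive x 1 f a -> is_derive x 1 (fun z => f z ^+ 2) (2 * f x * a).
Proof.
move=> fa; have := is_derive1_mul fa fa.
under eq_fun do rewrite -expr2.
by move=> h; apply: (is_derive_eq h); ring.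
Qed.

Lemma is_derive1_add f g (x a b : R) :
  is_derive x 1 f a -> is_derive x 1 g b ->
  is_derive x 1 (fun z => f z + g z) (a + b).
Proof. by move=> fa gb; apply: (@is_derive_eq _ _ _ (f + g)). Qed.

Lemma is_derive1_opp f (x a : R) :
  is_derive x 1 f a -> is_derive x 1 (fun z => - f z) (- a).
Proof. by move=> fa; apply: (@is_derive_eq _ _ _ (- f)). Qed.

Lemma is_derive1_sub f g (x a b : R) :
  is_derive x 1 f a -> is_derive x 1 g b ->
  is_derive x 1 (fun z => f z - g z) (a - b).
Proof. by move=> fa gb; apply: is_derive1_add => //; exact: is_derive1_opp. Qed.

Lemma is_derive1_scale f (k x a : R) :
  is_derive x 1 f a -> is_derive x 1 (fun z => k * f z) (k * a).
Proof.
move=> fa; have := is_derive1_mul (is_derive_cst k x 1) fa.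
by move=> h; apply: (is_derive_eq h); rewrite mul0r add0r.
Qed.

Lemma is_derive1_inv f (x a : R) : f x != 0 ->
  is_derive x 1 f a -> is_derive x 1 (fun z => (f z)^-1) (- a / f x ^+ 2).
Proof.
move=> f0 fa; apply: (is_derive_eq (is_deriveV f0 fa)).
by rewrite /GRing.scale /= !mulNr mulrC.
Qed.

Lemma is_derive1_dist f (x a : R) : is_derive x 1 f a ->
  forall e : R, 0 < e -> exists2 n : R, 0 < n &
    forall z, `|z - x| < n -> `|f z - f x| < e.
Proof.
move=> fa e e0.
have /differentiable_continuous : differentiable f x.
  by apply/derivable1_diffP; exact: ex_derive.
move=> /cvgrPdist_lt /(_ _ e0) [n /= n0 H]; exists n => // z zx.
by rewrite distrC; apply: H; rewrite /= distrC.
Qed.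

Lemma le_of_derive1_ge0 f (df : R -> R) (a b : R) : a <= b ->
  (forall x, a <= x <= b -> is_derive x 1 f (df x)) ->
  (forall x, a < x < b -> 0 <= df x) -> f a <= f b.
Proof.
rewrite le_eqVlt => /predU1P[->//|ab] dfx df0.
have [||c cab E] := @MVT R f df a b ab.
- by move=> x; rewrite in_itv /= => /andP[/ltW ? /ltW ?]; apply: dfx; apply/andP.
- apply: derivable_within_continuous => x; rewrite in_itv /= => xab.
  by have := dfx x xab => -[].
- rewrite -subr_ge0 E mulr_ge0//; last by rewrite subr_ge0 ltW.
  by apply: df0; move: cab; rewrite in_itv.
Qed.

Lemma ge_of_derive1_le0 f (df : R -> R) (a b : R) : a <= b ->
  (forall x, a <= x <= b -> is_derive x 1 f (df x)) ->
  (forall x, a < x < b -> df x <= 0) -> f b <= f a.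
Proof.
move=> ab dfx df0; rewrite -lerN2.
apply: (@le_of_derive1_ge0 (fun z => - f z) (fun z => - df z)) => // x xab.
  by apply: is_derive1_opp; exact: dfx.
by rewrite oppr_ge0; exact: df0.
Qed.

(* Only the behaviour of D just above 0 matters: after the last point where
   D <= 0, the function D is small and positive, hence nonincreasing. *)
Lemma barrier D (dD : R -> R) (a b e : R) : a <= b -> 0 < e ->
  (forall x, a <= x <= b -> is_derive x 1 D (dD x)) ->
  D a <= 0 ->
  (forall x, a <= x <= b -> 0 < D x < e -> dD x <= 0) -> D b <= 0.
Proof.
move=> ab e0 dDx Da H; rewrite leNgt; apply/negP => Db.
pose S := [set x | a <= x <= b /\ D x <= 0].
have Sa : S a by split; rewrite ?lexx.
have Sub : ubound S b by move=> x [/andP[]].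
have supS : has_sup S by split; [exists a|exists b].
pose c := sup S.
have ac : a <= c by apply: ub_le_sup => //; exists b.
have cb : c <= b by apply: ge_sup => //; exists a.
have cab : a <= c <= b by apply/andP.
have Dc : D c <= 0.
  rewrite leNgt; apply/negP => Dc0.
  have [n n0 Hn] := is_derive1_dist (dDx _ cab) Dc0.
  have [x Sx cx] := sup_adherent n0 supS.
  have xc : x <= c by apply: ub_le_sup => //; exists b.
  have /Hn : `|x - c| < n by rewrite ler0_norm ?subr_le0// opprB ltrBlDr -ltrBlDl.
  rewrite ltr_norml => /andP[+ _]; rewrite ltrBrDl subrr => Dx.
  by case: Sx => _; rewrite leNgt Dx.
have cb' : c < b.
  by rewrite lt_neqAle cb andbT; apply/eqP => E; move: Db; rewrite -E ltNge Dc.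
have [n n0 Hn] := is_derive1_dist (dDx _ cab) e0.
have Dpos z : c < z -> z <= b -> 0 < D z.
  move=> cz zb; rewrite ltNge; apply/negP => Dz.
  have : z <= c.
    apply: ub_le_sup; first by exists b.
    by split => //; rewrite zb andbT (le_trans ac)// ltW.
  by rewrite leNgt cz.
pose t := Num.min b (c + n / 2).
have ct : c < t by rewrite lt_min cb' ltrDl divr_gt0.
have tb : t <= b by rewrite ge_min lexx.
have tn : t - c < n.
  have : t <= c + n / 2 by rewrite ge_min lexx orbT.
  by lra.
have : D t <= D c.
  apply: (@ge_of_derive1_le0 D dD) => [|x /andP[cx xt]|x /andP[cx xt]].
  - exact: ltW.
  - by apply: dDx; rewrite (le_trans ac cx) (le_trans xt tb).
  - apply: H; first by rewrite (le_trans ac (ltW cx)) (le_trans (ltW xt) tb).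
    rewrite Dpos ?(le_trans (ltW xt))//=.
    have /Hn : `|x - c| < n by rewrite ger0_norm; lra.
    by rewrite ltr_norml => /andP[_]; lra.
by have := Dpos t ct tb; lra.
Qed.

End Calculus.

(** * The radial equation *)

(* p is the radial profile, N = d - 1, del = omega_star - omega, and
   q = - p' / (p (1 - p^(2 alpha))). *)
Record droplet (R : realType) (N alpha del : R) (p q : R -> R) : Prop := Droplet {
  droplet_gt0 : forall r : R, 0 < r -> 0 < p r ;
  droplet_lt1 : forall r : R, 0 < r -> p r < 1 ;
  droplet_slope_ge0 : forall r : R, 0 < r -> 0 <= q r ;
  droplet_derive : forall r : R, 0 < r ->
    is_derive r 1 p (- (p r * (1 - p r `^ (2 * alpha)) * q r)) ;
  droplet_slope_derive : forall r : R, 0 < r ->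
    is_derive r 1 q
      ((q r ^+ 2 - omega_star alpha) * (1 - (1 + alpha) * p r `^ (2 * alpha))
       + del - N * q r / r) ;
  droplet_vanishes : forall e : R, 0 < e ->
    exists2 t : R, 0 < t & forall r : R, t <= r -> p r < e ;
  droplet_slope0 : forall e : R, 0 < e ->
    exists2 s : R, 0 < s & forall r : R, 0 < r <= s -> q r < e
}.

Section Droplet.
Variables (R : realType) (N alpha : R).
Hypotheses (N_gt0 : 0 < N) (alpha_gt0 : 0 < alpha).
Implicit Types r s t x : R.

Local Notation ws := (omega_star alpha).
Local Notation a := (Num.sqrt ws).

Lemma omega_star_gt0 : 0 < ws.
Proof. by rewrite divr_gt0// addr_gt0. Qed.

Lemma omega_star_lt1 : ws < 1.
Proof. by rewrite /omega_star ltr_pdivrMr ?mul1r ?ltrDl ?addr_gt0. Qed.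

Lemma sqrt_omega_star_gt0 : 0 < a.
Proof. by rewrite sqrtr_gt0 omega_star_gt0. Qed.

Lemma sqrt_omega_star_sqr : a ^+ 2 = ws.
Proof. by rewrite sqr_sqrtr// ltW// omega_star_gt0. Qed.

(** * Energy of one profile and its comparison with multiples of [p ^+ 2] *)

Section OneProfile.
Variables (del : R) (p q : R -> R).
Hypotheses (del_gt0 : 0 < del) (del_lt : del < ws).
Hypothesis hP : droplet N alpha del p q.

Let p_gt0 := droplet_gt0 hP.
Let p_lt1 := droplet_lt1 hP.
Let q_ge0 := droplet_slope_ge0 hP.
Let p_der := droplet_derive hP.

Local Notation y r := (p r `^ (2 * alpha)).

Lemma droplet_pow_gt0 r : 0 < r -> 0 < y r.
Proof. by move=> r0; rewrite powR_gt0// p_gt0. Qed.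

Lemma droplet_pow_lt1 r : 0 < r -> y r < 1.
Proof.
move=> r0; have al2 : 0 < 2 * alpha by rewrite mulr_gt0.
have := gt0_ltr_powR al2 _ _ (p_lt1 r0).
by rewrite powR1; apply; rewrite nnegrE// ltW// p_gt0.
Qed.

Lemma droplet_onem_gt0 r : 0 < r -> 0 < 1 - y r.
Proof. by move=> r0; rewrite subr_gt0 droplet_pow_lt1. Qed.

Lemma droplet_pow_derive r : 0 < r ->
  is_derive r 1 (fun s : R => y s) (- (2 * alpha * y r * (1 - y r) * q r)).
Proof.
move=> r0; have pr0 := p_gt0 r0.
have h := @is_derive1_comp _ (fun z : R => z `^ (2 * alpha)) p r _ _
  (is_derive1_powR _ pr0) (p_der r0).
apply: (is_derive_eq h) => /=.
have -> : p r `^ (2 * alpha) = p r `^ (2 * alpha - 1) * p r.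
  rewrite -[X in _ = _ * X](powRr1 (ltW pr0)) -powRD ?subrK//.
  by rewrite (gt_eqF pr0) implybT.
by ring.
Qed.

(* droplet_E is twice the energy of the radial equation, written as p^2 H. *)
Definition droplet_H r := (1 - y r) * (q r ^+ 2 - ws) + del.
Definition droplet_E r := p r ^+ 2 * droplet_H r.
Local Notation H := droplet_H.
Local Notation E := droplet_E.

(** Apart from the friction this is [H' = 2 q (1 - y) H], thanks to the constant [del] in [H]; in
    [E] this term cancels against the derivative of [p ^+ 2]. *)
Lemma droplet_H_derive r : 0 < r ->
  is_derive r 1 H (2 * q r * (1 - y r) * (H r - N * q r / r)).
Proof.
move=> r0; have dq := droplet_slope_derive hP r0.
have dy := is_derive1_sub (is_derive_cst (1 : R) r 1) (droplet_pow_derive r0).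
have dq2 := is_derive1_sub (is_derive1_sqr dq) (is_derive_cst ws r 1).
have dH := is_derive1_add (is_derive1_mul dy dq2) (is_derive_cst del r 1).
apply: (is_derive_eq dH); rewrite /droplet_H /cst.
by field; rewrite gt_eqF.
Qed.

Lemma droplet_E_derive r : 0 < r ->
  is_derive r 1 E (- (2 * N * (p r ^+ 2 * (1 - y r) * q r ^+ 2) / r)).
Proof.
move=> r0.
have dE := is_derive1_mul (is_derive1_sqr (p_der r0)) (droplet_H_derive r0).
apply: (is_derive_eq dE); rewrite /droplet_H.
by field; rewrite gt_eqF.
Qed.

Lemma droplet_noninc r s : 0 < r -> r <= s -> p s <= p r.
Proof.
move=> r0 rs.
apply: (@ge_of_derive1_le0 _ p (fun r => - (p r * (1 - y r) * q r)) r s rs).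
  by move=> x /andP[rx _]; apply: p_der; exact: lt_le_trans rx.
move=> x /andP[rx _]; have x0 := lt_trans r0 rx.
rewrite oppr_le0 !mulr_ge0 ?q_ge0 ?(ltW (p_gt0 _))//.
exact/ltW/droplet_onem_gt0.
Qed.

Lemma droplet_pow_noninc r s : 0 < r -> r <= s -> y s <= y r.
Proof.
move=> r0 rs; have s0 := lt_le_trans r0 rs.
apply: ge0_ler_powR; rewrite ?nnegrE ?mulr_ge0// ?(ltW alpha_gt0) ?(ltW (p_gt0 _))//.
exact: droplet_noninc.
Qed.

Lemma droplet_E_noninc r s : 0 < r -> r <= s -> E s <= E r.
Proof.
move=> r0 rs; apply: (ge_of_derive1_le0 rs).
  by move=> x /andP[rx _]; apply: droplet_E_derive; exact: lt_le_trans rx.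
move=> x /andP[rx _]; have x0 := lt_trans r0 rx.
rewrite oppr_le0 divr_ge0 ?(ltW x0)// !mulr_ge0 ?(ltW N_gt0) ?(ltW (p_gt0 x0)) ?q_ge0//.
exact/ltW/droplet_onem_gt0.
Qed.

Lemma droplet_sqr_lt1 r : 0 < r -> 0 < p r ^+ 2 <= p r.
Proof.
move=> r0; rewrite exprn_gt0 ?p_gt0//= expr2 ger_pMr ?p_gt0//.
by rewrite ltW// p_lt1.
Qed.

(** A crude bound: it yields [E >= - p ^+ 2], which vanishes at infinity. *)
Lemma droplet_H_geN1 s : 0 < s -> -1 <= H s.
Proof.
move=> s0; have h1 := mulr_ge0 (ltW (droplet_onem_gt0 s0)) (sqr_ge0 (q s)).
have h2 := mulr_gt0 (droplet_pow_gt0 s0) omega_star_gt0.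
have w1 := omega_star_lt1.
by rewrite /droplet_H; have := del_gt0; lra.
Qed.

(** Since [E] is nonincreasing, a negative value would persist, against [E >= - p ^+ 2] with [p]
    tending to 0. *)
Lemma droplet_E_ge0 r : 0 < r -> 0 <= E r.
Proof.
move=> r0; rewrite leNgt; apply/negP => Er.
have Er' : 0 < - E r by rewrite oppr_gt0.
have [t t0 pt] := droplet_vanishes hP Er'.
pose s := Num.max r t.
have rs : r <= s by rewrite le_max lexx.
have s0 := lt_le_trans r0 rs.
have /pt ps : t <= s by rewrite le_max lexx orbT.
have Es := droplet_E_noninc r0 rs.
have /andP[p20 p2] := droplet_sqr_lt1 s0.
have Hs := droplet_H_geN1 s0.
have : p s ^+ 2 * (- 1) <= E s by rewrite /droplet_E ler_pM2l.
by lra.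
Qed.

Lemma droplet_H_ge0 r : 0 < r -> 0 <= H r.
Proof.
move=> r0; have := droplet_E_ge0 r0.
by rewrite /droplet_E pmulr_rge0// exprn_gt0// p_gt0.
Qed.

Lemma droplet_E_le r : 0 < r -> E r <= del.
Proof.
move=> r0; apply/ler_addgt0Pr => e e0.
(* The cap 1 gives [q ^+ 2 <= q <= e] at [t], so the slope adds at most [e] to [H]. *)
have e1 : 0 < Num.min e 1 by rewrite lt_min e0/=.
have [s s0 qs] := droplet_slope0 hP e1.
pose t := Num.min r s.
have t0 : 0 < t by rewrite lt_min r0.
have tr : t <= r by rewrite ge_min lexx.
have /qs : 0 < t <= s by rewrite t0 ge_min lexx orbT.
rewrite lt_min => /andP[qe q1].
apply: (le_trans (droplet_E_noninc t0 tr)).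
have /andP[p20 p2] := droplet_sqr_lt1 t0.
have pt1 := p_lt1 t0.
have Ht := droplet_H_ge0 t0.
have : H t <= del + e.
  have q0 := q_ge0 t0.
  have q2 : q t ^+ 2 <= e by rewrite expr2; nra.
  have h1 := mulr_ge0 (ltW (droplet_pow_gt0 t0)) (sqr_ge0 (q t)).
  have h2 := mulr_gt0 (droplet_onem_gt0 t0) omega_star_gt0.
  by rewrite /droplet_H; have := del_gt0; lra.
apply: le_trans; rewrite /droplet_E.
by rewrite ler_piMl//; lra.
Qed.

(** Beyond [r] one has [N q / s <= N Q / r = c], so [E - c p ^+ 2] is nondecreasing. It is at most a
    multiple of [p ^+ 2], which vanishes at infinity, hence it is nonpositive at [r]. *)
Lemma droplet_H_upper r Q : 0 < r -> (forall s, r <= s -> q s <= Q) ->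
  H r <= N * Q / r.
Proof.
move=> r0 qQ; pose c := N * Q / r.
have Q0 : 0 <= Q by apply: le_trans (qQ _ (lexx r)); exact: q_ge0.
have c0 : 0 <= c by rewrite /c divr_ge0 ?(ltW r0)// mulr_ge0// ltW.
pose F s := E s - c * p s ^+ 2.
have F_nd s : r <= s -> F r <= F s.
  move=> rs; apply: (@le_of_derive1_ge0 _ F (fun s =>
     2 * (p s ^+ 2 * (1 - y s) * q s) * (c - N * q s / s)) _ _ rs).
    move=> x /andP[rx _]; have x0 := lt_le_trans r0 rx.
    have dF := is_derive1_sub (droplet_E_derive x0)
      (is_derive1_scale c (is_derive1_sqr (p_der x0))).
    by apply: (is_derive_eq dF); field; rewrite gt_eqF.
  move=> x /andP[rx _]; have x0 := lt_trans r0 rx.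
  apply: mulr_ge0.
    rewrite !mulr_ge0 ?(ltW (p_gt0 x0)) ?q_ge0//; exact/ltW/droplet_onem_gt0.
  rewrite subr_ge0 /c ler_pM ?mulr_ge0 ?q_ge0 ?invr_ge0 ?(ltW N_gt0) ?(ltW x0)//.
    by rewrite ler_pM2l// qQ// ltW.
  by rewrite lef_pV2 ?posrE// ltW.
have Fr : F r <= 0.
  rewrite leNgt; apply/negP => Fr.
  have B0 : 0 < Q ^+ 2 + 1 by have := sqr_ge0 Q; lra.
  have [t t0 pt] := droplet_vanishes hP (divr_gt0 Fr B0).
  pose s := Num.max r t.
  have rs : r <= s by rewrite le_max lexx.
  have s0 := lt_le_trans r0 rs.
  have /pt ps : t <= s by rewrite le_max lexx orbT.
  have /andP[p20 p2] := droplet_sqr_lt1 s0.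
  have Hs : H s <= Q ^+ 2 + 1.
    have q2 : q s ^+ 2 <= Q ^+ 2 by rewrite lerXn2r ?nnegrE ?q_ge0// qQ.
    have h1 := mulr_ge0 (ltW (droplet_pow_gt0 s0)) (sqr_ge0 (q s)).
    have h2 := mulr_gt0 (droplet_onem_gt0 s0) omega_star_gt0.
    have w1 := omega_star_lt1.
    by rewrite /droplet_H; have := del_lt; lra.
  have : F s <= p s ^+ 2 * (Q ^+ 2 + 1).
    rewrite /F /droplet_E lerBlDr ler_wpDr//; first by rewrite mulr_ge0// ltW.
    by rewrite ler_pM2l.
  move: ps; rewrite ltr_pdivlMr// => ps.
  have : p s ^+ 2 * (Q ^+ 2 + 1) <= p s * (Q ^+ 2 + 1) by rewrite ler_pM2r.
  by have := F_nd s rs; lra.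
have /andP[p20 _] := droplet_sqr_lt1 r0.
by rewrite -(ler_pM2l p20) mulrC -subr_le0 [_ ^+ 2 * (_ / _)]mulrC [H r * _]mulrC.
Qed.

(** The reverse comparison: on [[r, s]] the quotient [N q / x] is at least [c = N l / s], so [E]
    drops at least as much as [c p ^+ 2], and what is left at [s] is nonnegative. *)
Lemma droplet_E_lower r s l : 0 < r -> r <= s -> 0 <= l ->
  (forall x, r <= x <= s -> l <= q x) ->
  N * l / s * (p r ^+ 2 - p s ^+ 2) <= E r.
Proof.
move=> r0 rs l0 lq; have s0 := lt_le_trans r0 rs.
pose c := N * l / s; pose F x := E x - c * p x ^+ 2.
suff : F s <= F r by rewrite /F mulrBr -/c; have := droplet_E_ge0 s0; lra.
apply: (@ge_of_derive1_le0 _ F (fun s =>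
     2 * (p s ^+ 2 * (1 - y s) * q s) * (c - N * q s / s)) _ _ rs).
  move=> x /andP[rx _]; have x0 := lt_le_trans r0 rx.
  have dF := is_derive1_sub (droplet_E_derive x0)
    (is_derive1_scale c (is_derive1_sqr (p_der x0))).
  by apply: (is_derive_eq dF); field; rewrite gt_eqF.
move=> x /andP[rx xs]; have x0 := lt_trans r0 rx.
apply: mulr_ge0_le0.
  rewrite !mulr_ge0 ?(ltW (p_gt0 x0)) ?q_ge0//; exact/ltW/droplet_onem_gt0.
rewrite subr_le0 /c ler_pM ?mulr_ge0 ?invr_ge0 ?(ltW N_gt0) ?(ltW s0)//.
  by rewrite ler_pM2l// lq// !ltW.
by rewrite lef_pV2 ?posrE// ltW.
Qed.

End OneProfile.
End Droplet.

(** * Bounds on the slope and flatness of the core *)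

Section DropletBarriers.
Variables (R : realType) (N alpha : R).
Hypotheses (N_gt0 : 0 < N) (alpha_gt0 : 0 < alpha).
Implicit Types r s t x del : R.
Implicit Types p q : R -> R.

Local Notation ws := (omega_star alpha).
Local Notation a := (Num.sqrt ws).
Local Notation dq del p q r :=
  ((q r ^+ 2 - ws) * (1 - (1 + alpha) * p r `^ (2 * alpha))
       + del - N * q r / r).

Lemma droplet_pow_vanishes del p q : droplet N alpha del p q ->
  forall e : R, 0 < e ->
  exists2 t : R, 0 < t & forall r, t <= r -> p r `^ (2 * alpha) < e.
Proof.
move=> hP e e0; have al2 : 0 < 2 * alpha by rewrite mulr_gt0.
have [t t0 pt] := droplet_vanishes hP (powR_gt0 (2 * alpha)^-1 e0).
exists t => // r tr.
have := gt0_ltr_powR al2 _ _ (pt _ tr).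
rewrite -powRrM mulVf ?gt_eqF// powRr1 ?(ltW e0)//; apply.
  by rewrite nnegrE ltW// (droplet_gt0 hP)// (lt_le_trans t0).
by rewrite nnegrE powR_ge0.
Qed.

(* q' >= c q^2 far out, so 1/q would become negative. *)
Lemma droplet_no_blowup del p q r1 eta : 0 < del -> droplet N alpha del p q ->
  0 < r1 -> 0 < eta -> (forall s, r1 <= s -> a + eta <= q s) -> False.
Proof.
move=> del0 hP r10 eta0 qlb.
have a0 : 0 < a := sqrt_omega_star_gt0 alpha_gt0.
have aa : a ^+ 2 = ws := sqrt_omega_star_sqr alpha_gt0.
pose b := a + eta; have b0 : 0 < b by rewrite addr_gt0.
(* [q >= b] gives [q ^+ 2 - ws >= 4 c q ^+ 2]. Half of it survives once [(1 + alpha) y < 1 / 2], and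
   the friction takes at most [c q ^+ 2] when [r >= N / (c b)]; at least [c q ^+ 2] remains. *)
pose c := eta / b / 4; have c0 : 0 < c by rewrite !divr_gt0.
have cb0 : 0 < c * b by rewrite mulr_gt0.
have e0 : 0 < (2 * (1 + alpha))^-1 by rewrite invr_gt0 mulr_gt0// addr_gt0.
have [t t0 yt] := droplet_pow_vanishes hP e0.
pose r2 := Num.max (Num.max r1 t) (N / (c * b)).
have r12 : r1 <= r2 by rewrite !le_max lexx.
have r20 := lt_le_trans r10 r12.
have Hq s : r2 <= s -> c * q s ^+ 2 <= dq del p q s.
  move=> r2s; have s0 := lt_le_trans r20 r2s.
  have qs : b <= q s by apply: qlb; exact: le_trans r2s.
  have /yt : t <= s by rewrite (le_trans _ r2s)// !le_max lexx orbT.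
  rewrite -[X in _ < X]mul1r ltr_pdivlMr ?mulr_gt0 ?addr_gt0// => ys.
  have Ns : N / s <= c * b.
    have : N / (c * b) <= s by rewrite (le_trans _ r2s)// !le_max lexx orbT.
    by move=> h; rewrite ler_pdivrMr// mulrC -ler_pdivrMr.
  have h1 : N * q s / s <= c * q s ^+ 2.
    rewrite mulrAC expr2 mulrA ler_wpM2r//; first exact: ltW (lt_le_trans b0 qs).
    by rewrite (le_trans Ns)// ler_pM2l.
  have h2 : 4 * c * q s ^+ 2 <= q s ^+ 2 - ws.
    have -> : 4 * c = eta / b by rewrite /c; field; rewrite gt_eqF.
    rewrite -aa -(ler_pM2l b0).
    have -> : b * (eta / b * q s ^+ 2) = eta * q s ^+ 2 by field; rewrite gt_eqF.
    suff : a * (a * b) <= a * q s ^+ 2 by rewrite /b; lra.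
    rewrite ler_pM2l// expr2; apply: ler_pM => //; rewrite ?(ltW a0) ?(ltW b0)//.
    by rewrite (le_trans _ qs)// /b lerDl ltW.
  have h3 : 0 <= c * q s ^+ 2 by rewrite mulr_ge0 ?sqr_ge0 ?ltW.
  have : (4 * c * q s ^+ 2) * (1 / 2) <=
      (q s ^+ 2 - ws) * (1 - (1 + alpha) * p s `^ (2 * alpha)).
    apply: ler_pM => //; first by rewrite -mulrA mulr_ge0.
    by lra.
  by lra.
have qpos s : r2 <= s -> 0 < q s.
  by move=> r2s; apply: (lt_le_trans b0); apply: qlb; exact: le_trans r2s.
pose F x := - (q x)^-1 - c * x.
have Fnd s : r2 <= s -> F r2 <= F s.
  move=> r2s; apply: (@le_of_derive1_ge0 _ F
      (fun x => dq del p q x / q x ^+ 2 - c) _ _ r2s) => x /andP[r2x _].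
    have x0 := lt_le_trans r20 r2x.
    have qx : q x != 0 by rewrite gt_eqF// qpos.
    have dF := is_derive1_sub
      (is_derive1_opp (is_derive1_inv qx (droplet_slope_derive hP x0)))
      (is_derive1_scale c (is_derive_id x 1)).
    by apply: (is_derive_eq dF); field; rewrite qx gt_eqF.
  have r2x' := ltW r2x.
  by rewrite subr_ge0 ler_pdivlMr ?exprn_gt0 ?qpos// Hq.
have cq0 : 0 < c * q r2 by rewrite mulr_gt0// qpos.
(* At this point the lower bound on [- 1 / q] reaches 0, although [q] is still positive. *)
have r2s : r2 <= r2 + (c * q r2)^-1 by rewrite lerDl invr_ge0 ltW.
have := Fnd _ r2s.
have : 0 < (q (r2 + (c * q r2)^-1))^-1 by rewrite invr_gt0 qpos.
have E : c * (c * q r2)^-1 = (q r2)^-1.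
  by rewrite invfM mulrA mulfV ?mul1r ?gt_eqF.
by rewrite /F mulrDr E; lra.
Qed.

(** An excess slope reinforces itself. Where [1 - y >= e], [q > a + eta] makes [H - del >= th]. As
    long as [H - del > th / 2], one has [q >= b > a], and for large radii [H] beats the friction, so
    [H] cannot fall. Thus [q >= b] for ever, which [droplet_no_blowup] excludes. *)
Lemma droplet_slope_le_outside (eta e : R) : 0 < eta -> 0 < e ->
  exists2 r0 : R, 0 < r0 & forall del p q, 0 < del -> del < ws ->
    droplet N alpha del p q ->
    forall r, r0 <= r -> e <= 1 - p r `^ (2 * alpha) -> q r <= a + eta.
Proof.
move=> eta0 e0.
have a0 : 0 < a := sqrt_omega_star_gt0 alpha_gt0.
have aa : a ^+ 2 = ws := sqrt_omega_star_sqr alpha_gt0.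
have ws0 : 0 < ws := omega_star_gt0 alpha_gt0.
pose th := e * eta ^+ 2; have th0 : 0 < th by rewrite mulr_gt0// exprn_gt0.
pose b := Num.sqrt (ws + th / 2).
have wt : 0 < ws + th / 2 by rewrite addr_gt0// divr_gt0.
have bb : b ^+ 2 = ws + th / 2 by rewrite sqr_sqrtr// ltW.
have ab : a < b by rewrite ltr_sqrt// ltrDl divr_gt0.
pose eta1 := b - a; have eta10 : 0 < eta1 by rewrite subr_gt0.
have cb0 : 0 < e * eta1 by rewrite mulr_gt0.
exists (N / (e * eta1)); first by rewrite divr_gt0// mulr_gt0.
move=> del p q del0 delw hP r r0r er; rewrite leNgt; apply/negP => qr.
have r0 : 0 < r by apply: lt_le_trans r0r; rewrite divr_gt0// mulr_gt0.
have q0 s : r <= s -> 0 <= q s.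
  by move=> rs; apply: (droplet_slope_ge0 hP); exact: lt_le_trans rs.
have yb s : r <= s -> e <= 1 - p s `^ (2 * alpha) < 1.
  move=> rs; have s0 := lt_le_trans r0 rs.
  have := droplet_pow_noninc alpha_gt0 hP r0 rs.
  have := droplet_pow_gt0 hP s0.
  by move=> *; apply/andP; split; lra.
have Hr : th <= droplet_H alpha del p q r - del.
  rewrite /droplet_H addrK /th ler_pM ?(ltW e0) ?sqr_ge0//.
  by rewrite -aa; have := mulr_gt0 a0 eta0; nra.
have big s : r <= s -> th / 2 < droplet_H alpha del p q s - del -> b <= q s.
  move=> rs; rewrite /droplet_H addrK => h.
  have /andP[y1 y2] := yb s rs.
  have : th / 2 < q s ^+ 2 - ws.
    rewrite (lt_le_trans h)// ler_piMl ?(ltW y2)//.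
    rewrite leNgt; apply/negP => neg.
    have : (1 - p s `^ (2 * alpha)) * (q s ^+ 2 - ws) < 0.
      by rewrite pmulr_rlt0// (lt_le_trans e0).
    by lra.
  move=> h'; rewrite -(@ler_pXn2r _ 2) ?nnegrE ?q0 ?sqrtr_ge0// bb; lra.
have Hs s : r <= s -> th <= droplet_H alpha del p q s - del.
  move=> rs; rewrite -subr_le0.
  pose D x := th - (droplet_H alpha del p q x - del).
  have th20 : 0 < th / 2 by rewrite divr_gt0.
  apply: (@barrier _ D (fun x => - (2 * q x * (1 - p x `^ (2 * alpha)) *
      (droplet_H alpha del p q x - N * q x / x))) _ _ _ rs th20).
  - move=> x /andP[rx _]; have x0 := lt_le_trans r0 rx.
    have dD := is_derive1_sub (is_derive_cst th x 1)
      (is_derive1_sub (droplet_H_derive hP x0)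
         (is_derive_cst del x 1)).
    by apply: (is_derive_eq dD); ring.
  - by rewrite subr_le0.
  - move=> x /andP[rx _] /andP[D0 D1].
    have x0 := lt_le_trans r0 rx.
    have qb : b <= q x by apply: (big _ rx); move: D1; rewrite /D; lra.
    have /andP[y1 y2] := yb x rx.
    rewrite oppr_le0 mulr_ge0//.
      by rewrite mulr_ge0 ?mulr_ge0 ?q0// (le_trans (ltW e0)).
    have Nx : N / x <= e * eta1.
      have : N / (e * eta1) <= x by exact: le_trans rx.
      by move=> h; rewrite ler_pdivrMr// mulrC -ler_pdivrMr.
    have h1 : N * q x / x <= e * eta1 * q x.
      by rewrite mulrAC ler_wpM2r// q0.
    have h2 : e * (eta1 * q x) <= (1 - p x `^ (2 * alpha)) * (q x ^+ 2 - ws).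
      rewrite ler_pM// ?(ltW e0) ?mulr_ge0 ?q0 ?(ltW eta10)//.
      rewrite -aa /eta1.
      have : (b - a) * q x <= (q x - a) * (q x + a).
        by rewrite ler_pM ?q0 ?lerB ?lerDl ?(ltW a0) ?subr_ge0 ?(ltW ab).
      by lra.
    by rewrite /droplet_H; lra.
apply: (droplet_no_blowup del0 hP r0 eta10) => s rs.
have -> : a + eta1 = b by rewrite /eta1; ring.
by apply: big => //; have := Hs _ rs; lra.
Qed.

(* a + eta/2 + 1/(k r) with k = alpha/2 is a supersolution, infinite at 0. *)
Lemma droplet_slope_le_inside (eta : R) del p q r : 0 < eta -> 0 < r ->
  0 < del -> del < ws -> del <= alpha / 2 * (a * eta) ->
  droplet N alpha del p q ->
  1 + alpha / 2 <= (1 + alpha) * p r `^ (2 * alpha) ->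
  q r <= a + eta / 2 + (alpha / 2 * r)^-1.
Proof.
move=> eta0 r0 del0 delw dele hP yr.
have al0 := alpha_gt0; have N0 := N_gt0.
have a0 : 0 < a := sqrt_omega_star_gt0 alpha_gt0.
have aa : a ^+ 2 = ws := sqrt_omega_star_sqr alpha_gt0.
pose k := alpha / 2; have k0 : 0 < k by rewrite divr_gt0.
have [s s0 qs] := droplet_slope0 hP a0.
pose t := Num.min r s.
have t0 : 0 < t by rewrite lt_min r0.
have tr : t <= r by rewrite ge_min lexx.
have /qs qt : 0 < t <= s by rewrite t0 ge_min lexx orbT.
rewrite -/k -subr_le0.
pose D x := q x - (a + eta / 2 + (k * x)^-1).
apply: (@barrier _ D (fun x => dq del p q x + k * ((k * x)^-1) ^+ 2) t r 1) => //.
- move=> x /andP[tx _]; have x0 := lt_le_trans t0 tx.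
  have kx : k * x != 0 by rewrite mulf_neq0 ?gt_eqF.
  have dD := is_derive1_sub (droplet_slope_derive hP x0) (is_derive1_add
    (is_derive_cst (a + eta / 2) x 1)
    (is_derive1_inv kx (is_derive1_scale k (is_derive_id x 1)))).
  by apply: (is_derive_eq dD); field; rewrite !gt_eqF.
- rewrite /D; have : 0 < (k * t)^-1 by rewrite invr_gt0 mulr_gt0.
  by lra.
- move=> x /andP[tx xr]; have x0 := lt_le_trans t0 tx.
  rewrite /D; have : 0 < (k * x)^-1 by rewrite invr_gt0 mulr_gt0.
  set z := (k * x)^-1 => z0 /andP[D0 _].
  have qB : a + eta / 2 + z < q x by lra.
  have q2 : a * eta + z ^+ 2 <= q x ^+ 2 - ws.
    have : (a + eta / 2 + z) ^+ 2 <= q x ^+ 2.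
      by rewrite lerXn2r ?nnegrE ?(ltW qB)//; lra.
    have := mulr_gt0 a0 z0; have := mulr_gt0 eta0 z0; have := mulr_gt0 eta0 eta0.
    by rewrite -subr_ge0; lra.
  have yx : 1 + k <= (1 + alpha) * p x `^ (2 * alpha).
    rewrite (le_trans yr)// ler_pM2l ?addr_gt0//.
    exact: (droplet_pow_noninc alpha_gt0 hP x0 xr).
  have q20 : 0 <= a * eta + z ^+ 2 by rewrite addr_ge0 ?sqr_ge0 ?mulr_ge0 ?ltW.
  (* Here [k * (a * eta)] absorbs [del], and [k * z ^+ 2] absorbs the derivative of the
     supersolution. *)
  have h1 : (a * eta + z ^+ 2) * k <=
      (q x ^+ 2 - ws) * ((1 + alpha) * p x `^ (2 * alpha) - 1).
    by apply: ler_pM => //; [exact: ltW|lra].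
  have h2 : 0 <= N * q x / x.
    by rewrite !mulr_ge0 ?invr_ge0 ?(ltW N0) ?(ltW x0)//; lra.
  move: dele; rewrite -/k; lra.
Qed.

Lemma droplet_slope_le (eta : R) : 0 < eta ->
  exists r0 d0 : R, [/\ 0 < r0, 0 < d0 & forall del p q, 0 < del -> del < ws ->
    del <= d0 -> droplet N alpha del p q -> forall r, r0 <= r -> q r <= a + eta].
Proof.
move=> eta0.
have al0 := alpha_gt0.
have a0 : 0 < a := sqrt_omega_star_gt0 alpha_gt0.
(* The value of [1 - y] at which [(1 + alpha) y = 1 + alpha / 2], where the inside and outside
   regimes meet. *)
pose e := alpha / 2 / (1 + alpha).
have e0 : 0 < e by rewrite !divr_gt0// addr_gt0.
have [r0 r00 H0] := droplet_slope_le_outside eta0 e0.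
(* Beyond this radius the singular term of the supersolution is at most [eta / 2]. *)
have t0 : 0 < 2 / (alpha / 2 * eta) by rewrite divr_gt0// mulr_gt0// divr_gt0.
exists (Num.max r0 (2 / (alpha / 2 * eta))), (alpha / 2 * (a * eta)); split.
- by rewrite lt_max r00.
- by rewrite !mulr_gt0// invr_gt0.
move=> del p q del0 delw dele hP r; rewrite ge_max => /andP[r0r tr].
have [yr|yr] := leP (1 + alpha / 2) ((1 + alpha) * p r `^ (2 * alpha)).
  have rp : 0 < r := lt_le_trans t0 tr.
  apply: (le_trans (droplet_slope_le_inside eta0 rp del0 delw dele hP yr)).
  rewrite -addrA lerD2l -lerBrDl.
  have -> : eta - eta / 2 = eta / 2 by field.
  move: tr; rewrite ler_pdivrMr; last by rewrite mulr_gt0// divr_gt0.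
  move=> tr.
  rewrite -[X in X <= _]mul1r ler_pdivrMr; last by rewrite mulr_gt0// divr_gt0.
  by lra.
apply: (H0 del p q) => //.
by rewrite /e ler_pdivrMr ?addr_gt0//; lra.
Qed.

(** Chosen so that [kap (1 + alpha + N) <= ws alpha / 2]: along the subsolution its derivative, the
    term in [q ^+ 2] and the friction cost at most [kap], [kap alpha] and [kap N]. The cap 1 gives
    [q ^+ 2 <= q]. *)
Definition droplet_slope_rate := Num.min 1 (ws * (alpha / 2) / (1 + alpha + N)).
Local Notation kap := droplet_slope_rate.

Lemma droplet_slope_rate_gt0 : 0 < kap.
Proof.
rewrite lt_min ltr01/=; have al0 := alpha_gt0; have N0 := N_gt0.
have ws0 := omega_star_gt0 al0.
by apply: divr_gt0; [apply: mulr_gt0 => //; lra|lra].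
Qed.

(* kap r / (1 + r) is a subsolution as long as p is close to 1. *)
Lemma droplet_slope_ge del p q r : 0 < r -> 0 < del -> droplet N alpha del p q ->
  1 + alpha / 2 <= (1 + alpha) * p r `^ (2 * alpha) ->
  kap * (r / (1 + r)) <= q r.
Proof.
move=> r0 del0 hP yr; apply/ler_addgt0Pl => e e0.
have al0 := alpha_gt0; have N0 := N_gt0.
have ws0 : 0 < ws := omega_star_gt0 alpha_gt0.
have kap0 := droplet_slope_rate_gt0.
have kap1 : kap <= 1 by rewrite ge_min lexx.
have kapw : kap * (1 + alpha + N) <= ws * (alpha / 2).
  by rewrite -ler_pdivlMr ?addr_gt0// ge_min lexx orbT.
(* The equation is singular at 0, so the comparison starts at a small [t > 0]; the slack [e] covers
   [kap t], and [q t >= 0] suffices. *)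
pose t := Num.min r (e / kap).
have t0 : 0 < t by rewrite lt_min r0 divr_gt0.
have tr : t <= r by rewrite ge_min lexx.
have te : kap * t <= e by rewrite mulrC -ler_pdivlMr// ge_min lexx orbT.
rewrite -lerBlDl -subr_le0.
pose D x := kap * (x / (1 + x)) - e - q x.
apply: (@barrier _ D (fun x => kap / (1 + x) ^+ 2 - dq del p q x) t r 1) => //.
- move=> x /andP[tx _]; have x0 := lt_le_trans t0 tx.
  have x1 : 1 + x != 0 by rewrite gt_eqF// addr_gt0.
  have dx := is_derive1_add (is_derive_cst (1 : R) x 1) (is_derive_id x 1).
  have dD := is_derive1_sub (is_derive1_sub
     (is_derive1_scale kap (is_derive1_mul (is_derive_id x 1)
        (is_derive1_inv x1 dx))) (is_derive_cst e x 1))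
     (droplet_slope_derive hP x0).
  by apply: (is_derive_eq dD); rewrite /cst /=; field; rewrite x1 gt_eqF.
- rewrite /D; have := droplet_slope_ge0 hP t0.
  have : kap * (t / (1 + t)) <= kap * t.
    rewrite ler_pM2l// ler_pdivrMr ?addr_gt0// ler_pMr//.
    by rewrite lerDl ltW.
  by lra.
- move=> x /andP[tx xr] /andP[D0 _]; have x0 := lt_le_trans t0 tx.
  have x1 : 0 < 1 + x by rewrite addr_gt0.
  have q0 := droplet_slope_ge0 hP x0.
  have qB : q x <= kap * (x / (1 + x)) by move: D0; rewrite /D; lra.
  have u0 : 0 < (1 + x)^-1 by rewrite invr_gt0.
  have u1 : (1 + x)^-1 <= 1 by rewrite invf_le1// lerDl ltW.
  have qx : q x / x <= kap.
    rewrite ler_pdivrMr// (le_trans qB)// ler_pM2l// ler_piMr// ltW//.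
  have qk : q x <= kap.
    rewrite (le_trans qB)// ler_piMr ?(ltW kap0)//.
    by rewrite ler_pdivrMr// mul1r lerDr.
  have k2 : kap / (1 + x) ^+ 2 <= kap.
    by rewrite -exprVn ler_piMr ?(ltW kap0)// expr_le1// ltW.
  have h2 : N * q x / x <= N * kap by rewrite -mulrA ler_pM2l.
  have q2 : q x ^+ 2 <= kap.
    by rewrite expr2; apply: (le_trans _ qk); rewrite ler_piMl//; lra.
  have y1 := droplet_pow_lt1 alpha_gt0 hP x0.
  have yx : 1 + alpha / 2 <= (1 + alpha) * p x `^ (2 * alpha).
    rewrite (le_trans yr)// ler_pM2l ?addr_gt0//.
    exact: (droplet_pow_noninc alpha_gt0 hP x0 xr).
  have z1 : alpha / 2 <= (1 + alpha) * p x `^ (2 * alpha) - 1 by lra.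
  have z2 : (1 + alpha) * p x `^ (2 * alpha) - 1 <= alpha.
    have : (1 + alpha) * p x `^ (2 * alpha) <= 1 + alpha.
      by rewrite ler_piMr ?ltW// addr_gt0.
    by lra.
  have h3 : ws * (alpha / 2) <= ws * ((1 + alpha) * p x `^ (2 * alpha) - 1).
    by rewrite ler_pM2l.
  have h4 : q x ^+ 2 * ((1 + alpha) * p x `^ (2 * alpha) - 1) <= kap * alpha.
    by apply: ler_pM => //; rewrite ?sqr_ge0//; lra.
  by lra.
Qed.

(** On [[r, r1]], [y >= 1 / 2] and [q >= kap / 2], so [1 - y] grows at relative rate at least
    [alpha kap / 2]. The exponential is weakened to [expR z >= z ^+ 2 / 4]: with [r1 - r] of order
    [1 / del], this already bounds [1 - y] by a multiple of [del ^+ 2], negligible against [del]. *)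
Lemma droplet_onem_decay del p q r r1 : 1 <= r -> r <= r1 -> 0 < del ->
  droplet N alpha del p q ->
  1 + alpha / 2 <= (1 + alpha) * p r1 `^ (2 * alpha) ->
  (1 - p r `^ (2 * alpha)) * (alpha * kap / 2 * (r1 - r)) ^+ 2 <= 4.
Proof.
move=> r1' rr del0 hP yr; have r0 : 0 < r by apply: lt_le_trans r1'.
have al0 := alpha_gt0; have r10 := lt_le_trans r0 rr.
have kap0 := droplet_slope_rate_gt0.
pose c := alpha * kap / 2; have c0 : 0 < c by rewrite divr_gt0// mulr_gt0.
pose G x := (1 - p x `^ (2 * alpha)) * expR (- c * x).
have : G r <= G r1.
  apply: (@le_of_derive1_ge0 _ G (fun x => (2 * alpha * p x `^ (2 * alpha) *
    q x - c) * ((1 - p x `^ (2 * alpha)) * expR (- c * x))) _ _ rr) => x.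
    move=> /andP[rx _]; have x0 := lt_le_trans r0 rx.
    have dy := is_derive1_sub (is_derive_cst (1 : R) x 1)
      (droplet_pow_derive hP x0).
    have de := @is_derive1_comp _ expR (fun z : R => - c * z) x _ _
      (is_derive_expR _) (is_derive1_scale (- c) (is_derive_id x 1)).
    by apply: (is_derive_eq (is_derive1_mul dy de)); rewrite /cst /=; ring.
  move=> /andP[/ltW rx /ltW xr]; have x0 := lt_le_trans r0 rx.
  have yx : 1 + alpha / 2 <= (1 + alpha) * p x `^ (2 * alpha).
    rewrite (le_trans yr)// ler_pM2l ?addr_gt0//.
    exact: (droplet_pow_noninc alpha_gt0 hP x0 xr).
  apply: mulr_ge0; last first.
    by rewrite mulr_ge0 ?expR_ge0 ?(ltW (droplet_onem_gt0 alpha_gt0 hP x0)).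
  have y2 : 1 / 2 <= p x `^ (2 * alpha).
    by rewrite -(@ler_pM2l _ (1 + alpha)) ?addr_gt0//; lra.
  have qk : kap / 2 <= q x.
    apply: (le_trans _ (droplet_slope_ge x0 del0 hP yx)).
    rewrite ler_pM2l// ler_pdivlMr ?addr_gt0//.
    by have := le_trans r1' rx; lra.
  have : 1 / 2 * (kap / 2) <= p x `^ (2 * alpha) * q x.
    by apply: ler_pM => //; lra.
  by rewrite subr_ge0 -(ler_pM2l al0) /c; lra.
rewrite /G => h.
have y1 := droplet_pow_gt0 hP r10.
have h1 : (1 - p r `^ (2 * alpha)) * expR (c * (r1 - r)) <= 1.
  have -> : c * (r1 - r) = - c * r + c * r1 by ring.
  rewrite expRD mulrA.
  apply: (@le_trans _ _ ((1 - p r1 `^ (2 * alpha)) * expR (- c * r1) * expR (c * r1))).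
    by rewrite ler_wpM2r// expR_ge0.
  by rewrite -mulrA -expRD mulNr addNr expR0 mulr1; lra.
set z := c * (r1 - r) in h1 *.
have z0 : 0 <= z by rewrite mulr_ge0 ?subr_ge0 ?(ltW c0).
have ez : z ^+ 2 / 4 <= expR z.
  have -> : z ^+ 2 / 4 = (z / 2) * (z / 2) by field.
  have -> : expR z = expR (z / 2) * expR (z / 2) by rewrite -expRD; congr expR; field.
  by have e1 := expR_ge1Dx (z / 2); apply: ler_pM; lra.
have m0 := ltW (droplet_onem_gt0 alpha_gt0 hP r0).
have := ler_wpM2l m0 ez.
by lra.
Qed.

End DropletBarriers.

(** * Position and width of the front *)

Section DropletRadius.
Variables (R : realType) (N alpha : R).
Hypotheses (N_gt0 : 0 < N) (alpha_gt0 : 0 < alpha).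
Implicit Types r s t x del : R.
Implicit Types p q : R -> R.

Local Notation ws := (omega_star alpha).
Local Notation a := (Num.sqrt ws).

(** [H >= 0] reads [(1 - y) (ws - q ^+ 2) <= del]; where [1 - y >= m], a small [del] keeps [q] from
    lying far below [a]. *)
Lemma droplet_slope_ge_sqrt del p q r t (m : R) : 0 < del ->
  droplet N alpha del p q -> 0 < r -> 0 <= t <= 1 -> 0 < m ->
  m <= 1 - p r `^ (2 * alpha) -> del <= m * (ws * (1 - (1 - t) ^+ 2)) ->
  a * (1 - t) <= q r.
Proof.
move=> del0 hP r0 /andP[t0 t1] m0 mr dm.
have aa : a ^+ 2 = ws := sqrt_omega_star_sqr alpha_gt0.
have ws0 : 0 < ws := omega_star_gt0 alpha_gt0.
have q0 := droplet_slope_ge0 hP r0.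
rewrite -(@ler_pXn2r _ 2) ?nnegrE ?mulr_ge0 ?sqrtr_ge0 ?subr_ge0// exprMn aa.
have := droplet_H_ge0 N_gt0 alpha_gt0 del0 hP r0; rewrite /droplet_H => h.
rewrite leNgt; apply/negP => lt.
have gap : ws * (1 - (1 - t) ^+ 2) < ws - q r ^+ 2 by lra.
have gap0 : 0 <= ws * (1 - (1 - t) ^+ 2) by rewrite mulr_ge0 ?(ltW ws0)//; nra.
have : m * (ws * (1 - (1 - t) ^+ 2)) < (1 - p r `^ (2 * alpha)) * (ws - q r ^+ 2).
  apply: (@lt_le_trans _ _ (m * (ws - q r ^+ 2))); first by rewrite ltr_pM2l.
  by rewrite ler_wpM2r//; lra.
by lra.
Qed.

(** Near the origin [q ^+ 2 <= ws / 2], so [H >= 0] gives [(1 - y) ws / 2 <= del]: the profile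
    starts above [v], and it vanishes at infinity. *)
Lemma droplet_attains del p q (v : R) : 0 < del ->
  droplet N alpha del p q -> 0 < v -> del < ws * (1 - v `^ (2 * alpha)) / 2 ->
  exists2 r, 0 < r & p r = v.
Proof.
move=> del0 hP v0 dv; have ws0 : 0 < ws := omega_star_gt0 alpha_gt0.
have al2 : 0 <= 2 * alpha by rewrite mulr_ge0// ltW.
have e0 : 0 < Num.min 1 (ws / 2) by rewrite lt_min ltr01 divr_gt0.
have [s s0 qs] := droplet_slope0 hP e0.
have [t t0 pt] := droplet_vanishes hP v0.
have /qs : 0 < s <= s by rewrite s0 lexx.
rewrite lt_min => /andP[q1 q2].
have ps : v < p s.
  rewrite ltNge; apply/negP => psv.
  have q0 := droplet_slope_ge0 hP s0.
  have ps0 := droplet_gt0 hP s0.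
  have yv : p s `^ (2 * alpha) <= v `^ (2 * alpha).
    by apply: ge0_ler_powR; rewrite ?nnegrE ?(ltW v0) ?(ltW ps0).
  have y1 := droplet_onem_gt0 alpha_gt0 hP s0.
  have := droplet_H_ge0 N_gt0 alpha_gt0 del0 hP s0; rewrite /droplet_H.
  have q2' : q s ^+ 2 <= ws / 2 by rewrite expr2; nra.
  have : (1 - p s `^ (2 * alpha)) * (ws / 2) <=
      (1 - p s `^ (2 * alpha)) * (ws - q s ^+ 2) by rewrite ler_pM2l//; lra.
  have : ws / 2 * (1 - v `^ (2 * alpha)) <= ws / 2 * (1 - p s `^ (2 * alpha)).
    by rewrite ler_pM2l ?divr_gt0//; lra.
  by lra.
have st : s <= t.
  rewrite leNgt; apply/negP => ts.
  by have := pt _ (ltW ts); lra.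
have [] := @IVT R p s t v st.
- apply: derivable_within_continuous => x; rewrite in_itv /= => /andP[sx _].
  by have := droplet_derive hP (lt_le_trans s0 sx) => -[].
- have := pt t (lexx _) => ptv.
  by rewrite ge_min le_max (ltW ps) (ltW ptv) orbT.
- move=> c; rewrite in_itv /= => /andP[sc _] pc; exists c => //.
  exact: lt_le_trans sc.
Qed.

(** On [[r, s]] the profile falls at rate at least [v m l], and in total by less than 1. *)
Lemma droplet_width del p q r s (l m v : R) : 0 < r -> r <= s -> 0 <= l ->
  0 <= m -> 0 <= v -> droplet N alpha del p q ->
  (forall x, r <= x <= s -> l <= q x) -> m <= 1 - p r `^ (2 * alpha) ->
  v <= p s -> v * m * l * (s - r) <= 1.
Proof.
move=> r0 rs l0 m0 v0 hP lq mr vs.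
pose F x := p x + v * m * l * x.
have : F s <= F r.
  apply: (@ge_of_derive1_le0 _ F (fun x =>
    - (p x * (1 - p x `^ (2 * alpha)) * q x) + v * m * l) _ _ rs) => x.
    move=> /andP[rx _]; have x0 := lt_le_trans r0 rx.
    have dF := is_derive1_add (droplet_derive hP x0)
      (is_derive1_scale (v * m * l) (is_derive_id x 1)).
    by apply: (is_derive_eq dF); rewrite mulr1.
  move=> /andP[/ltW rx /ltW xs]; have x0 := lt_le_trans r0 rx.
  have y1 := droplet_pow_noninc alpha_gt0 hP r0 rx.
  have px := droplet_noninc alpha_gt0 hP x0 xs.
  rewrite addrC subr_le0; apply: ler_pM; rewrite ?mulr_ge0//.
    by apply: ler_pM => //; lra.
  by apply: lq; rewrite rx.
have := droplet_lt1 hP r0; have := droplet_gt0 hP (lt_le_trans r0 rs).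
by rewrite /F; lra.
Qed.

(* Interior energy estimate at (1 - t) r1, where 1 - p^(2 alpha) has already
   become exponentially small. *)
Lemma droplet_radius_upper del p q r1 (Q t c : R) : 0 < del -> del < ws ->
  droplet N alpha del p q -> 0 < t < 1 -> 1 <= (1 - t) * r1 ->
  1 + alpha / 2 <= (1 + alpha) * p r1 `^ (2 * alpha) ->
  (forall r, (1 - t) * r1 <= r -> q r <= Q) ->
  c = alpha * droplet_slope_rate N alpha / 2 ->
  4 <= t * del * (c * (t * r1)) ^+ 2 ->
  del * (1 - t) * ((1 - t) * r1) <= N * Q.
Proof.
move=> del0 delw hP /andP[t0 t1] r11 yr qQ cE big.
pose r : R := (1 - t) * r1.
have r0 : 0 < r by apply: lt_le_trans r11.
have r10 : 0 < r1 by move: r0; rewrite /r pmulr_rgt0// subr_gt0.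
have rr : r <= r1 by rewrite /r ler_piMl ?ltW//; lra.
have := droplet_H_upper N_gt0 alpha_gt0 delw hP r0 qQ.
rewrite ler_pdivlMr// => Hr.
apply: (le_trans _ Hr); rewrite ler_pM2r//.
have dec := droplet_onem_decay N_gt0 alpha_gt0 r11 rr del0 hP yr.
rewrite -cE in dec.
have rE : r1 - (1 - t) * r1 = t * r1 by ring.
rewrite rE in dec.
have w1 := omega_star_lt1 alpha_gt0.
have ws0 : 0 < ws := omega_star_gt0 alpha_gt0.
(* With [z = c t r1], [dec] bounds [(1 - y) z ^+ 2] by 4, and [big] bounds 4 by [t del z ^+ 2]. *)
have mt : 1 - p r `^ (2 * alpha) <= t * del.
  rewrite -(@ler_pM2r _ ((c * (t * r1)) ^+ 2)); first exact: le_trans dec big.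
  rewrite lt_neqAle sqr_ge0 andbT eq_sym; apply/eqP => z.
  by move: big; rewrite z mulr0; lra.
have m0 := droplet_onem_gt0 alpha_gt0 hP r0.
have h1 : 0 <= (1 - p r `^ (2 * alpha)) * q r ^+ 2 by rewrite mulr_ge0 ?sqr_ge0// ltW.
have h2 : (1 - p r `^ (2 * alpha)) * ws <= t * del * 1 by apply: ler_pM => //; exact: ltW.
by rewrite /droplet_H; lra.
Qed.

Lemma ge0_ler_pow_alpha (z w : R) : 0 <= z -> z <= w ->
  z `^ (2 * alpha) <= w `^ (2 * alpha).
Proof.
move=> z0 zw; have w0 := le_trans z0 zw.
by apply: ge0_ler_powR; rewrite ?nnegrE// mulr_ge0// ltW.
Qed.

(** The front is cut at [p = 1 - t] and [p = t]. The third condition puts the inner end within reach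
    of the core estimates; the last keeps [1 - y >= 1 / 2] beyond the outer end. *)
Lemma exists_layer (e : R) : 0 < e -> exists t : R,
  [/\ 0 < t, t <= e, 1 + alpha / 2 <= (1 + alpha) * (1 - t) `^ (2 * alpha)
    & t `^ (2 * alpha) <= 1 / 2].
Proof.
move=> e0; have al0 := alpha_gt0.
have powK (z : R) : 0 <= z -> (z `^ (2 * alpha)^-1) `^ (2 * alpha) = z.
  by move=> z0; rewrite -powRrM mulVf ?powRr1// gt_eqF// mulr_gt0.
pose z := (1 + alpha / 2) / (1 + alpha).
have z1 : z < 1 by rewrite ltr_pdivrMr; lra.
have z0 : 0 <= z by rewrite divr_ge0; lra.
have u1 : z `^ (2 * alpha)^-1 < 1.
  have := @gt0_ltr_powR R (2 * alpha)^-1 _ z 1.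
  by rewrite powR1; apply; rewrite ?nnegrE ?invr_gt0 ?mulr_gt0.
have h0 : 0 < (1 / 2 : R) by lra.
have v0 := powR_gt0 (2 * alpha)^-1 h0.
pose t := Num.min e (Num.min (1 - z `^ (2 * alpha)^-1)
  ((1 / 2) `^ (2 * alpha)^-1)).
have t0 : 0 < t by rewrite !lt_min e0 subr_gt0 u1.
have tz : z `^ (2 * alpha)^-1 <= 1 - t.
  have : t <= 1 - z `^ (2 * alpha)^-1 by rewrite !ge_min lexx orbT.
  by lra.
exists t; split => //.
- by rewrite ge_min lexx.
- have := ge0_ler_pow_alpha (powR_ge0 _ _) tz; rewrite (powK z z0) /z.
  rewrite ler_pdivrMr; last by lra.
  by rewrite [(1 + alpha) * _]mulrC.
- rewrite -[leRHS]powK; last exact: ltW.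
  by apply: ge0_ler_pow_alpha; rewrite ?(ltW t0)// !ge_min lexx !orbT.
Qed.

Lemma droplet_radii del p q (t m : R) : 0 < del -> droplet N alpha del p q ->
  0 < t < 1 / 2 -> 0 < m -> m = 1 - (1 - t) `^ (2 * alpha) ->
  del <= ws * m / 4 ->
  exists r1 r2, [/\ 0 < r1, r1 <= r2, p r1 = 1 - t & p r2 = t].
Proof.
move=> del0 hP /andP[t0 t1] m0 mE dl.
have ws0 : 0 < ws := omega_star_gt0 alpha_gt0.
have wm : 0 < ws * m by rewrite mulr_gt0.
have [r1 r10 pr1] : exists2 r, 0 < r & p r = 1 - t.
  apply: (droplet_attains del0 hP); first by lra.
  by rewrite -mE; lra.
have [r2 r20 pr2] : exists2 r, 0 < r & p r = t.
  apply: (droplet_attains del0 hP) => //.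
  have h : t `^ (2 * alpha) <= (1 - t) `^ (2 * alpha).
    by apply: ge0_ler_pow_alpha; lra.
  have : ws * m <= ws * (1 - t `^ (2 * alpha)) by rewrite ler_pM2l//; lra.
  by lra.
exists r1, r2; split => //.
rewrite leNgt; apply/negP => /ltW r21.
by have := droplet_noninc alpha_gt0 hP r20 r21; lra.
Qed.

(** The layer from [r1] to [r2] loses at least [N a (1 - t) / r2] times
    [(1 - t) ^+ 2 - t ^+ 2 = 1 - 2 t], out of an energy of at most [del]. Its width is at most
    [(t m a (1 - t))^-1], negligible at the scale [1 / del]. *)
Lemma droplet_radius_lower del p q r1 r2 (t m : R) :
  0 < del -> droplet N alpha del p q ->
  0 < t < 1 -> 0 < m -> m = 1 - p r1 `^ (2 * alpha) ->
  0 < r1 -> r1 <= r2 -> p r1 = 1 - t -> p r2 = t ->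
  (forall r, r1 <= r -> a * (1 - t) <= q r) ->
  del <= t * (N * a) * (t * m * (a * (1 - t))) ->
  N * a * (1 - t) * (1 - 2 * t) <= del * r2 /\
  del * r2 <= del * r1 + t * (N * a).
Proof.
move=> del0 hP /andP[t0 t1] m0 mE r10 r12 pr1 pr2 ql dl.
have a0 : 0 < a := sqrt_omega_star_gt0 alpha_gt0.
have r20 := lt_le_trans r10 r12.
have l0 : 0 < a * (1 - t) by rewrite mulr_gt0// subr_gt0.
split.
  have : N * (a * (1 - t)) / r2 * (p r1 ^+ 2 - p r2 ^+ 2) <= del.
    apply: le_trans (droplet_E_le N_gt0 alpha_gt0 del0 hP r10).
    apply: (droplet_E_lower N_gt0 alpha_gt0 del0 hP r10 r12 (ltW l0)).
    by move=> x /andP[? _]; exact: ql.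
  rewrite -(ler_pM2r r20) pr1 pr2; apply: le_trans.
  rewrite le_eqVlt; apply/orP; left; apply/eqP.
  by field; rewrite gt_eqF.
have tml : 0 < t * m * (a * (1 - t)) := mulr_gt0 (mulr_gt0 t0 m0) l0.
have wid : t * m * (a * (1 - t)) * (r2 - r1) <= 1.
  apply: (droplet_width r10 r12 (ltW l0) (ltW m0) (ltW t0) hP).
  - by move=> x /andP[? _]; exact: ql.
  - by rewrite mE.
  - by rewrite pr2.
have : del * (r2 - r1) <= t * (N * a) * (t * m * (a * (1 - t))) * (r2 - r1).
  by rewrite ler_wpM2r// subr_ge0.
have : t * (N * a) * (t * m * (a * (1 - t)) * (r2 - r1)) <= t * (N * a) * 1.
  rewrite ler_wpM2l// mulr_ge0 ?(ltW t0)// mulr_ge0 ?(ltW a0)//.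
  exact: ltW N_gt0.
by clear dl wid; lra.
Qed.

(** [r1 >= L / (2 del)] makes the right-hand side at least [t (c t L) ^+ 2 / (4 del)], whence the
    16. *)
Lemma droplet_decay_threshold (c t L del r1 : R) : 0 < c -> 0 < t -> 0 < L ->
  0 < del -> L / 2 <= del * r1 -> del <= t * (c * t * L) ^+ 2 / 16 ->
  4 <= t * del * (c * (t * r1)) ^+ 2.
Proof.
move=> c0 t0 L0 del0 Lr dl.
have ct0 : 0 < c * t := mulr_gt0 c0 t0.
have L20 : 0 < L / 2 by lra.
have h : (c * t * (L / 2)) ^+ 2 <= (c * t * (del * r1)) ^+ 2.
  apply: lerXn2r; rewrite ?nnegrE; [| |by rewrite ler_pM2l].
    exact/ltW/mulr_gt0.
  by apply/ltW/mulr_gt0 => //; lra.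
have h' : t * (c * t * (L / 2)) ^+ 2 <= t * (c * t * (del * r1)) ^+ 2.
  by rewrite ler_pM2l.
by rewrite -(ler_pM2l del0); lra.
Qed.

(** The logarithmic derivative of [p s * s ^+ n.+1] is [n.+1 / s - (1 - y) q]. *)
Lemma droplet_tail del p q r2 n : droplet N alpha del p q -> 0 < r2 ->
  (forall r, r2 <= r -> n.+1%:R <= (1 - p r `^ (2 * alpha)) * q r * r) ->
  forall s, r2 <= s -> p s * s ^+ n.+1 <= p r2 * r2 ^+ n.+1.
Proof.
move=> hP r20 qn s r2s.
apply: (@ge_of_derive1_le0 _ (fun x => p x * x ^+ n.+1) (fun x =>
  p x * x ^+ n * (n.+1%:R - (1 - p x `^ (2 * alpha)) * q x * x)) _ _ r2s) => x.
  move=> /andP[r2x _]; have x0 := lt_le_trans r20 r2x.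
  have dX : is_derive x 1 (fun z : R => z ^+ n.+1) (n.+1%:R * x ^+ n).
    apply: DeriveDef; first exact: exprn_derivable.
    by rewrite exp_derive /= /GRing.scale /= mulr1.
  apply: (is_derive_eq (is_derive1_mul (droplet_derive hP x0) dX)).
  by rewrite exprS; ring.
move=> /andP[r2x _]; have x0 := lt_trans r20 r2x.
apply: mulr_ge0_le0; last by rewrite subr_le0 qn// ltW.
by rewrite mulr_ge0 ?exprn_ge0 ?(ltW x0)// ltW// (droplet_gt0 hP).
Qed.

End DropletRadius.

(** [d0] is fixed before the profile, so that the result applies along any family of solutions. The
    last clause, with [B] the dimension, feeds [droplet_tail]. *)
Lemma droplet_asymptotics (R : realType) (N alpha e B : R) :
  0 < N -> 0 < alpha -> 0 < e < 1 -> 0 <= B ->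
  exists2 d0, 0 < d0 & forall del (p q : R -> R), 0 < del -> del <= d0 ->
    droplet N alpha del p q ->
    exists r1 r2, [/\ 0 < r1 /\ r1 <= r2, 1 - e <= p r1 /\ p r2 <= e,
      N * Num.sqrt (omega_star alpha) * (1 - e) <= del * r1,
      del * r2 <= N * Num.sqrt (omega_star alpha) * (1 + e) &
      forall r, r2 <= r -> B <= (1 - p r `^ (2 * alpha)) * q r * r].
Proof.
move=> N_gt0 alpha_gt0 /andP[e0 e1] B0.
set ws := omega_star alpha; set a := Num.sqrt ws.
have a0 : 0 < a := sqrt_omega_star_gt0 alpha_gt0.
have ws0 : 0 < ws := omega_star_gt0 alpha_gt0.
(* The relative errors below add up to [4 t] from below and [6 t] from above. *)
have e10 : 0 < e / 10 by lra.
have [t [t0 te yt thalf]] := exists_layer alpha_gt0 e10.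
have t1 : t < 1 / 10 by lra.
have ot0 : 0 < 1 - t by lra.
pose m := 1 - (1 - t) `^ (2 * alpha).
have m0 : 0 < m.
  have := @gt0_ltr_powR R (2 * alpha) (mulr_gt0 (ltr0Sn R 1) alpha_gt0) (1 - t) 1.
  by rewrite powR1 /m subr_gt0 !nnegrE; apply; lra.
have [L [L0 LE]] : exists L, 0 < L /\ L = N * a.
  by exists (N * a); split=> //; rewrite mulr_gt0.
have [c [c0 cE]] : exists c, 0 < c /\ c = alpha * droplet_slope_rate N alpha / 2.
  exists (alpha * droplet_slope_rate N alpha / 2); split => //.
  by rewrite divr_gt0// mulr_gt0// droplet_slope_rate_gt0.
have at0 : 0 < a * t by rewrite mulr_gt0.
have [r0 [dA [r00 dA0 HA]]] := droplet_slope_le N_gt0 alpha_gt0 at0.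
have gap0 : 0 < 1 - (1 - t) ^+ 2.
  have : 0 < t * (2 - t) by apply: mulr_gt0; lra.
  by lra.
have l0 : 0 < a * (1 - t) := mulr_gt0 a0 ot0.
have d10 : 0 < ws * m / 4 := divr_gt0 (mulr_gt0 ws0 m0) (ltr0Sn R 3).
have d20 : 0 < m * (ws * (1 - (1 - t) ^+ 2)) := mulr_gt0 m0 (mulr_gt0 ws0 gap0).
have d30 : 0 < t * L * (t * m * (a * (1 - t))) :=
  mulr_gt0 (mulr_gt0 t0 L0) (mulr_gt0 (mulr_gt0 t0 m0) l0).
have r40 : 0 < 4 * (r0 + 1) by lra.
have d40 : 0 < L / (4 * (r0 + 1)) := divr_gt0 L0 r40.
have d50 : 0 < t * (c * t * L) ^+ 2 / 16.
  have ctL : 0 < c * t * L := mulr_gt0 (mulr_gt0 c0 t0) L0.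
  by apply: divr_gt0 => //; rewrite mulr_gt0// exprn_gt0.
have B8 : 0 < 8 * (B + 1) by lra.
have d60 : 0 < a * L / (8 * (B + 1)) := divr_gt0 (mulr_gt0 a0 L0) B8.
(* In order, the thresholds serve the upper slope bound, the existence of [r1] and [r2], the lower
   slope bound, the thinness of the front, [(1 - t) r1 >= r0 + 1], the decay of [1 - y] inside, and
   the tail bound [B]. *)
exists (Num.min dA (Num.min (ws * m / 4) (Num.min
  (m * (ws * (1 - (1 - t) ^+ 2))) (Num.min (t * L * (t * m * (a * (1 - t))))
  (Num.min (L / (4 * (r0 + 1))) (Num.min (t * (c * t * L) ^+ 2 / 16)
    (a * L / (8 * (B + 1))))))))).
  by rewrite !lt_min dA0 d10 d20 d30 d40 d50.
move=> del p q del0; rewrite !le_min.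
move=> /andP[dlA /andP[dl1 /andP[dl2 /andP[dl3 /andP[dl4 /andP[dl5 dl6]]]]]] hP.
have delw : del < ws.
  apply: (le_lt_trans dl1); rewrite ltr_pdivrMr//.
  rewrite ltr_pM2l// /m; have := powR_ge0 (1 - t) (2 * alpha).
  by clear; lra.
have t12 : 0 < t < 1 / 2 by rewrite t0/=; clear -t1; lra.
have [r1 [r2 [r10 r12 pr1 pr2]]] :=
  droplet_radii N_gt0 alpha_gt0 del0 hP t12 m0 erefl dl1.
have r20 := lt_le_trans r10 r12.
have mE : m = 1 - p r1 `^ (2 * alpha) by rewrite pr1.
have ql x : r1 <= x -> a * (1 - t) <= q x.
  move=> r1x; have x0 := lt_le_trans r10 r1x.
  apply: (droplet_slope_ge_sqrt N_gt0 alpha_gt0 del0 hP x0 _ m0 _ dl2).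
    by rewrite (ltW t0)/=; clear -t1; lra.
  by rewrite mE lerD2l lerN2; exact: (droplet_pow_noninc alpha_gt0 hP r10 r1x).
have t01 : 0 < t < 1 by rewrite t0/=; clear -t1; lra.
have [low2 wid] : L * (1 - t) * (1 - 2 * t) <= del * r2 /\
    del * r2 <= del * r1 + t * L.
  rewrite LE in dl3 *.
  exact: (droplet_radius_lower N_gt0 alpha_gt0 del0 hP t01 m0 mE r10 r12 pr1 pr2 ql).
(* [(1 - t) (1 - 2 t) - t = 1 - 4 t + 2 t ^+ 2]. *)
have low1 : L * (1 - 4 * t) <= del * r1.
  have : 0 <= L * t ^+ 2 by rewrite mulr_ge0 ?sqr_ge0// ltW.
  by clear -low2 wid; lra.
have low1' : L / 2 <= del * r1.
  have h : 2^-1 <= 1 - 4 * t by clear -t1; lra.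
  by apply: le_trans low1; rewrite ler_pM2l.
have r1big : r0 + 1 <= (1 - t) * r1.
  have h : 4 * (r0 + 1) * del <= L by rewrite mulrC -ler_pdivlMr.
  have : del * (2 * (r0 + 1)) <= del * r1 by clear -h low1'; lra.
  rewrite ler_pM2l// => h'.
  have : 0 <= (1 / 2 - t) * r1.
    by apply: mulr_ge0 (ltW r10); clear -t1; lra.
  by clear -h'; lra.
have up : del * (1 - t) * ((1 - t) * r1) <= N * (a + a * t).
  apply: (droplet_radius_upper N_gt0 alpha_gt0 del0 delw hP t01 _ _ _ cE).
  - by clear -r1big r00; lra.
  - by rewrite pr1.
  - move=> r hr; apply: (HA del p q) => //.
    by clear -r1big hr; lra.
  - exact: (droplet_decay_threshold c0 t0 L0 del0 low1' dl5).
exists r1, r2; rewrite pr1 pr2 -LE; split=> //.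
- by clear -te e0; lra.
- by apply: le_trans low1; rewrite ler_pM2l//; clear -te e0; lra.
(* [up] reads [(1 - t) ^+ 2 * (del * r1) <= L (1 + t)], and [(1 + t) / (1 - t) ^+ 2 <= 1 + 5 t] for
   [t < 1 / 10]; the width of the front adds one more [t]. *)
- have up' : del * r1 <= L * (1 + 5 * t).
    have u0 : 0 < (1 - t) * (1 - t) := mulr_gt0 ot0 ot0.
    have h1 : 1 + t <= (1 - t) * (1 - t) * (1 + 5 * t).
      have : 0 <= t * (2 - 9 * t) by apply: mulr_ge0; clear -t0 t1; lra.
      have : 0 <= t * t * t by rewrite !mulr_ge0// ltW.
      by clear; lra.
    have h2 : L * (1 + t) <= L * ((1 - t) * (1 - t) * (1 + 5 * t)) by rewrite ler_pM2l.
    rewrite -(ler_pM2l u0); clear -up h2 LE.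
    by move: h2; rewrite LE; lra.
  have : L * (1 + 6 * t) <= L * (1 + e) by rewrite ler_pM2l//; clear -te e0; lra.
  by clear -up' wid; lra.
(* [1 - y >= 1 / 2], [q >= a / 2] and [r >= L / (2 del)] make the product at least
   [a L / (8 del)]. *)
- move=> r r2r; have rp := lt_le_trans r20 r2r.
  have qr : a / 2 <= q r.
    apply: le_trans (ql _ (le_trans r12 r2r)).
    by rewrite ler_pM2l//; clear -t1; lra.
  have yr : 1 / 2 <= 1 - p r `^ (2 * alpha).
    have := droplet_pow_noninc alpha_gt0 hP r20 r2r; rewrite pr2.
    by clear -thalf; lra.
  have h : 1 / 2 * (a / 2) <= (1 - p r `^ (2 * alpha)) * q r.
    by apply: ler_pM => //; clear -a0; lra.
  have h' : L / 2 <= del * r.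
    by apply: (le_trans low1'); rewrite ler_pM2l// (le_trans r12).
  have h6 : del * (8 * (B + 1)) <= a * L by rewrite -ler_pdivlMr.
  apply: (@le_trans _ _ (1 / 2 * (a / 2) * r)); last by rewrite ler_pM2r.
  rewrite -(ler_pM2l del0).
  have : a * (L / 2) <= a * (del * r) by rewrite ler_pM2l.
  by clear -h6 del0; lra.
Qed.

(** * Volume of balls *)

Section LebesgueScaling.
Variable R : realType.
Local Open Scope ereal_scope.

Lemma measurable_scale (c : R) :
  measurable_fun [set: measurableTypeR R]
    (fun x : measurableTypeR R => c * x : measurableTypeR R)%R.
Proof. exact: mulrl_measurable. Qed.

(** Lebesgue measure is determined by its values on half-open intervals, where [c] times its
    push-forward under scaling by [c] agrees with it. *)
Lemma lebesgue_measure_scale (c : R) (A : set (measurableTypeR R)) :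
  (0 < c)%R -> measurable A ->
  lebesgue_measure A = c%:E * lebesgue_measure ((fun x : R => c * x)%R @^-1` A).
Proof.
move=> c0 mA; pose cn : {nonneg R} := NngNum (ltW c0).
pose pf := measure_function_pushforward__canonical__measure_function_Measure
   (@lebesgue_measure R) (measurable_scale c).
rewrite (@lebesgue_measure_unique R (mscale cn pf)) => [||//].
  by rewrite /mscale /= /pushforward.
move=> _ [[a b] /= _ <-]; rewrite /mscale /= /pushforward.
rewrite (_ : _ @^-1` _ = `](a / c)%R, (b / c)%R]%classic); last first.
  apply/seteqP; split => x /=; rewrite !in_itv /= ltr_pdivrMr// ler_pdivlMr//.
    by rewrite mulrC.
  by rewrite mulrC.
rewrite !lebesgue_measure_itv /= !lte_fin ltr_pM2r ?invr_gt0//.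
case: ifP => _; last by rewrite mule0.
by rewrite -!EFinB -EFinM -mulrBl mulrCA divff ?mulr1// gt_eqF.
Qed.

Definition scale_tuple n (c : R) (t : n.-tuple R) : n.-tuple R :=
  [tuple (c * tnth t i)%R | i < n].

Lemma measurable_scale_tuple n (c : R) :
  measurable_fun [set: n.-tuple R] (@scale_tuple n c).
Proof.
apply/measurable_fun_tnthP => i.
rewrite (_ : _ \o _ = fun t => c * tnth t i)%R; last first.
  by apply/funext => t /=; rewrite tnth_mktuple.
apply: measurable_funM => //; exact: measurable_tnth.
Qed.

Lemma scale_tuple_cons n (c x : R) (t : n.-tuple R) :
  scale_tuple c (tuple_cons (x, t)) = tuple_cons ((c * x)%R, scale_tuple c t).
Proof.
apply: eq_from_tnth => i; rewrite tnth_mktuple.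
have [j ->|->] := unliftP ord0 i; last by rewrite !tnth0.
by rewrite !tnthS tnth_mktuple.
Qed.

Lemma lebesgue_tupleS n (A : set (n.+1.-tuple R)) :
  lebesgue_tuple R n.+1 A =
  \int[lebesgue_tuple R n]_t
    lebesgue_measure (ysection (@tuple_cons R n @^-1` A) t).
Proof. by []. Qed.

(** The factor [c ^+ n] comes from substituting in the remaining coordinates, the last factor [c]
    from scaling each one-dimensional section. *)
Lemma lebesgue_tuple_scale n (c : R) (A : set (n.-tuple R)) :
  (0 < c)%R -> measurable A ->
  lebesgue_tuple R n A = (c ^+ n)%:E * lebesgue_tuple R n (scale_tuple c @^-1` A).
Proof.
move=> c0; elim: n A => [A mA|n IH A mA].
  rewrite expr0 mul1e; congr (lebesgue_tuple R 0 _).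
  by apply/seteqP; split => t /=; rewrite !(tuple0 (scale_tuple c t)) !(tuple0 t).
have mS : measurable (@tuple_cons R n @^-1` A).
  by rewrite -[X in measurable X]setTI; exact: measurable_tuple_cons.
have cn0 : (0 <= c ^+ n)%R by rewrite exprn_ge0// ltW.
pose cn : {nonneg R} := NngNum cn0.
pose pf := measure_function_pushforward__canonical__measure_function_Measure
   (lebesgue_tuple R n) (@measurable_scale_tuple n c).
pose g t := lebesgue_measure (ysection (@tuple_cons R n @^-1` A) t).
have mg : measurable_fun [set: n.-tuple R] g by exact: measurable_fun_ysection.
have g0 t : 0 <= g t by exact: measure_ge0.
rewrite !lebesgue_tupleS -/g.
(* The induction hypothesis is an equality of measures, so it passes to integrals. *)
transitivity (\int[mscale cn pf]_t g t).
  by apply: eq_measure_integral => B mB _; rewrite IH.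
rewrite ge0_integral_mscale//= ge0_integral_pushforward//; last first.
  exact: measurable_scale_tuple.
rewrite exprSr EFinM -muleA; congr (_ * _).
rewrite -ge0_integralZl//; last 2 first.
- apply: (@measurable_fun_ysection _ _ _ _ _ (@lebesgue_measure R)).
  rewrite -[X in measurable X]setTI -comp_preimage.
  apply: measurableT_comp => //; first exact: measurable_scale_tuple.
  exact: measurable_tuple_cons.
- by rewrite lee_fin ltW.
rewrite preimage_setT; apply: eq_integral => t _ /=; rewrite /g.
rewrite (@lebesgue_measure_scale c)//; last exact: measurable_ysection.
congr (_ * lebesgue_measure _).
apply/seteqP; split => x /=; rewrite /ysection /= !inE /= scale_tuple_cons//.
Qed.

End LebesgueScaling.

Section EuclideanBall.
Variable R : realType.
Local Open Scope ereal_scope.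

Definition eball n (r : R) : set (n.-tuple R) :=
  [set t | (enorm (row_of_tuple t) <= r)%R].
Arguments eball : clear implicits.

Lemma measurable_enorm n :
  measurable_fun [set: n.-tuple R] (fun t => enorm (row_of_tuple t)).
Proof.
apply: measurableT_comp.
  by apply: continuous_measurable_fun; exact: sqrt_continuous.
apply: measurable_sum => i; apply: measurable_funX.
rewrite (_ : (fun _ => _) = (fun t : n.-tuple R => tnth t i)).
  exact: measurable_tnth.
by apply/funext => t; rewrite mxE.
Qed.

Lemma measurable_eball n r : measurable (eball n r).
Proof.
have -> : eball n r =
    [set: n.-tuple R] `&` (fun t => enorm (row_of_tuple t)) @^-1` [set` `]-oo, r]%R].
  by apply/seteqP; split => t /=; rewrite in_itv /= => // -[].
apply: measurable_enorm => //; exact: measurable_itv.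
Qed.

Lemma enorm_scale_tuple n (c : R) (t : n.-tuple R) : (0 <= c)%R ->
  (enorm (row_of_tuple (scale_tuple c t)) = c * enorm (row_of_tuple t))%R.
Proof.
move=> c0; rewrite /enorm.
rewrite (eq_bigr (fun i => c ^+ 2 * (row_of_tuple t) ord0 i ^+ 2)%R); last first.
  by move=> i _; rewrite !mxE tnth_mktuple exprMn.
by rewrite -mulr_sumr sqrtrM ?sqr_ge0// sqrtr_sqr ger0_norm.
Qed.

Lemma eball_scale n (r : R) : (0 < r)%R ->
  lebesgue_tuple R n (eball n r) = (r ^+ n)%:E * lebesgue_tuple R n (eball n 1).
Proof.
move=> r0; rewrite (lebesgue_tuple_scale r0); last exact: measurable_eball.
congr (_ * lebesgue_tuple R n _); apply/seteqP.
by split => t; rewrite /eball /= enorm_scale_tuple ?(ltW r0)//;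
  rewrite -ler_pdivlMl// mulVf// gt_eqF.
Qed.

(** Encloses the unit ball to show that its volume is finite: the sections of a cube are intervals
    or empty, so its measure follows by induction. *)
Definition cube n : set (n.-tuple R) :=
  [set t | forall i : 'I_n, (`|tnth t i| <= 1)%R].

Lemma measurable_cube n : measurable (@cube n).
Proof.
have -> : @cube n = \bigcap_(i in [set: 'I_n])
    ([set: n.-tuple R] `&` (fun t => tnth t i) @^-1` [set` `[(-1)%R, 1%R]%R]).
  apply/seteqP; split => t /= h i.
    by move=> _; split => //=; rewrite in_itv /= -ler_norml.
  by have [//|_ /=] := h i; rewrite in_itv /= -ler_norml.
apply: fin_bigcap_measurable => // i _.
by apply: measurable_tnth => //; exact: measurable_itv.
Qed.

Lemma lebesgue_tuple_cube n : lebesgue_tuple R n (@cube n) < +oo.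
Proof.
elim: n => [|n IH]; first by rewrite /= diracE; case: (_ \in _); rewrite ?ltry.
suff E t : lebesgue_measure (ysection (@tuple_cons R n @^-1` @cube n.+1) t) =
    2%:E * (\1_(@cube n) t)%:E.
  rewrite lebesgue_tupleS (eq_integral _ _ (fun t _ => E t)) ge0_integralZl//.
  - by rewrite integral_indic ?setIT//; [exact: lte_mul_pinfty|exact: measurable_cube].
  - by apply/measurable_EFinP; apply: measurable_indic; exact: measurable_cube.
rewrite indicE.
have [tc|tc] := boolP (t \in @cube n).
  rewrite (_ : ysection _ _ = [set` `[(-1)%R, 1%R]%R]).
    rewrite lebesgue_measure_itv /= lte_fin ifT; last by lra.
    by rewrite -EFinB mule1; congr (_%:E); ring.
  apply/seteqP; split => x; rewrite /ysection /= in_itv /= -ler_norml inE /=.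
    by move=> /(_ ord0); rewrite tnth0.
  move=> x1 i; have [j ->|->] := unliftP ord0 i; rewrite ?tnth0 ?tnthS//.
  by move: tc; rewrite inE; exact.
rewrite (_ : ysection _ _ = set0) ?measure0 ?mule0//.
rewrite -subset0 => x; rewrite /ysection /= inE /= => h.
move/negP: tc; apply; rewrite inE => j.
by have := h (lift ord0 j); rewrite tnthS.
Qed.

Lemma eball_sub_cube n : eball n 1 `<=` @cube n.
Proof.
move=> t /= t1 i; rewrite -(@ler_pXn2r _ 2) ?nnegrE//.
rewrite expr1n real_normK ?num_real//.
have s0 : (0 <= \sum_j (row_of_tuple t) ord0 j ^+ 2)%R.
  by apply: sumr_ge0 => j _; exact: sqr_ge0.
have : (enorm (row_of_tuple t) ^+ 2 <= 1)%R.
  by rewrite expr_le1// sqrtr_ge0.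
rewrite sqr_sqrtr//; apply: le_trans.
rewrite (bigD1 i)//= mxE lerDl; apply: sumr_ge0 => j _; exact: sqr_ge0.
Qed.

Lemma eball1_fin_num n : lebesgue_tuple R n (eball n 1) \is a fin_num.
Proof.
rewrite ge0_fin_numE//; apply: le_lt_trans (lebesgue_tuple_cube n).
apply: le_measure; rewrite ?inE.
- exact: measurable_eball.
- exact: measurable_cube.
- exact: eball_sub_cube.
Qed.

Definition unit_ball_volume n : R := fine (lebesgue_tuple R n (eball n 1)).

Lemma unit_ball_volume_ge0 n : (0 <= unit_ball_volume n)%R.
Proof. by rewrite fine_ge0. Qed.

Lemma eball_volume n (r : R) : (0 < r)%R ->
  lebesgue_tuple R n (eball n r) = (r ^+ n * unit_ball_volume n)%:E.
Proof. by move=> r0; rewrite eball_scale// EFinM fineK// eball1_fin_num. Qed.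

Lemma integral_scale_tuple n (c : R) (D : set (n.-tuple R)) (g : n.-tuple R -> \bar R) :
  (0 < c)%R -> measurable D -> measurable_fun D g -> (forall t, 0 <= g t) ->
  \int[lebesgue_tuple R n]_(t in D) g t = (c ^+ n)%:E *
  \int[lebesgue_tuple R n]_(t in scale_tuple c @^-1` D) g (scale_tuple c t).
Proof.
move=> c0 mD mg g0.
have cn0 : (0 <= c ^+ n)%R by rewrite exprn_ge0// ltW.
pose cn : {nonneg R} := NngNum cn0.
pose pf := measure_function_pushforward__canonical__measure_function_Measure
   (lebesgue_tuple R n) (@measurable_scale_tuple R n c).
transitivity (\int[mscale cn pf]_(t in D) g t).
  by apply: eq_measure_integral => B mB _; rewrite (lebesgue_tuple_scale c0).
rewrite ge0_integral_mscale//= ge0_integral_pushforward//.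
exact: measurable_scale_tuple.
Qed.

End EuclideanBall.
Arguments eball {R}.

(** * Lower and upper bounds on the mass *)

Section L2Bounds.
Variables (R : realType) (n : nat) (f : 'rV[R]_n -> R).
Hypothesis L2f : L2 f.
Hypothesis f_ge0 : forall x, 0 <= f x.
Local Notation mu := (lebesgue_tuple R n).
Local Notation V := (unit_ball_volume R n).
Local Notation g t := (f (row_of_tuple t) ^+ 2)%:E.

Lemma measurable_L2 : measurable_fun [set: n.-tuple R] (f \o @row_of_tuple R n).
Proof. by move: L2f; rewrite /L2 inE /= => /andP[/set_mem]. Qed.

Lemma measurable_L2_sqr (D : set (n.-tuple R)) : measurable_fun D (fun t => g t).
Proof.
apply: measurable_funTS; apply/measurable_EFinP; apply: measurable_funX.
exact: measurable_L2.
Qed.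

Lemma L2norm_sqr : ((L2norm f ^+ 2)%:E = \int[mu]_t g t)%E.
Proof.
have fin : ('N[mu]_2%:E [EFin \o (f \o @row_of_tuple R n)] < +oo)%E.
  by move: L2f; rewrite /L2 inE /= => /andP[_ /set_mem].
have fin' : 'N[mu]_2%:E [EFin \o (f \o @row_of_tuple R n)]%E \is a fin_num.
  by rewrite ge0_fin_numE ?Lnorm_ge0.
have two0 : 2 != 0 :> R by rewrite pnatr_eq0.
have := poweR_Lnorm mu (EFin \o (f \o @row_of_tuple R n)) two0.
rewrite -(fineK fin') poweR_EFin -/(L2norm f) => h.
have L0 : 0 <= L2norm f by rewrite /L2norm fine_ge0// Lnorm_ge0.
rewrite -(powR_mulrn 2 L0) h; apply: eq_integral => t _ /=.
by rewrite powR_mulrn// real_normK// num_real.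
Qed.

Let g_ge0 (t : n.-tuple R) : (0 <= g t)%E.
Proof. by rewrite lee_fin sqr_ge0. Qed.

Lemma L2norm_ge (r v : R) : 0 < r -> 0 <= v ->
  (forall x, enorm x <= r -> v <= f x) -> v ^+ 2 * (r ^+ n * V) <= L2norm f ^+ 2.
Proof.
move=> r0 v0 fv; rewrite -lee_fin L2norm_sqr.
apply: (@le_trans _ _ (\int[mu]_(t in eball n r) g t)%E); last first.
  apply: ge0_subset_integral => //; first exact: measurable_eball.
  exact: measurable_L2_sqr.
rewrite EFinM -eball_volume// -integral_cst; last exact: measurable_eball.
apply: ge0_le_integral => //.
- exact: measurable_eball.
- by move=> t _; rewrite lee_fin sqr_ge0.
- exact: measurable_L2_sqr.
- move=> t /= tr; rewrite lee_fin lerXn2r ?nnegrE//; exact: fv.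
Qed.

Let outside r : set (n.-tuple R) := [set t | r < enorm (row_of_tuple t)].

Let outsideE r : outside r = ~` eball n r.
Proof.
by rewrite /outside /eball; apply/seteqP; split => t /=; rewrite ltNge => /negP.
Qed.

Let measurable_outside r : measurable (outside r).
Proof. by rewrite outsideE; apply: measurableC; exact: measurable_eball. Qed.

(* The tail over |x| > r equals the tail over r < |x| <= 2 r plus, after
   rescaling by 2, at most 2^-n times itself. *)
Lemma L2_outside_le (r e : R) : (0 < n)%N -> 0 < r -> 0 <= e ->
  (forall x, r < enorm x -> f x <= e) ->
  (forall x, r < enorm x -> 2 ^+ n * f (2 *: x) <= f x) ->
  (\int[mu]_(t in outside r) g t <= (2 * (e ^+ 2 * ((2 * r) ^+ n * V)))%:E)%E.
Proof.
move=> n0 r0 e0 fe f2.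
set I := (\int[mu]_(t in outside r) g t)%E.
have I0 : (0 <= I)%E by exact: integral_ge0.
(* Finiteness is what allows [I / 2] to be absorbed at the end. *)
have Ifin : I \is a fin_num.
  rewrite ge0_fin_numE//; apply: (@le_lt_trans _ _ (\int[mu]_t g t)%E).
    by apply: ge0_subset_integral => //; exact: measurable_L2_sqr.
  by rewrite -L2norm_sqr ltry.
pose A := outside r `&` eball n (2 * r).
have mA : measurable A.
  by apply: measurableI; [exact: measurable_outside|exact: measurable_eball].
have AE : outside r = A `|` outside (2 * r).
  apply/seteqP; split => t /=.
    move=> rt; rewrite /A /outside /eball /=.
    by have [h|h] := leP (enorm (row_of_tuple t)) (2 * r); [left|right].
  by case=> [[]//|]; rewrite /outside /=; apply: lt_trans; lra.
have dis : [disjoint A & outside (2 * r)].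
  apply/disj_set2P; rewrite -subset0 => t [[_ /= h1]]; rewrite /outside /=.
  by rewrite ltNge h1.
have IE : I = (\int[mu]_(t in A) g t + \int[mu]_(t in outside (2 * r)%R) g t)%E.
  rewrite /I [in LHS]AE ge0_integral_setU//; exact: measurable_L2_sqr.
have IA : (\int[mu]_(t in A) g t <= (e ^+ 2 * ((2 * r) ^+ n * V))%:E)%E.
  apply: (@le_trans _ _ (\int[mu]_(t in A) cst (e ^+ 2)%:E t)%E).
    apply: ge0_le_integral => //; first exact: measurable_L2_sqr.
    by move=> t [/= h _]; rewrite lee_fin lerXn2r ?nnegrE//; exact: fe.
  rewrite integral_cst// [X in (_ <= X)%E]EFinM -eball_volume ?mulr_gt0//.
  rewrite lee_wpmul2l ?lee_fin ?sqr_ge0// le_measure ?inE//.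
    exact: measurable_eball.
  by move=> t [].
have mS : measurable_fun [set: n.-tuple R] (fun t => g (scale_tuple 2 t)).
  apply/measurable_EFinP; apply: measurable_funX.
  pose F := f \o @row_of_tuple R n.
  apply: (@measurableT_comp _ _ _ _ _ _ F _ (scale_tuple 2)).
    exact: measurable_L2.
  exact: measurable_scale_tuple.
have IB : (\int[mu]_(t in outside (2 * r)%R) g t <= (2^-1)%:E * I)%E.
  rewrite (@integral_scale_tuple R n 2)//; last exact: measurable_L2_sqr.
  have -> : scale_tuple 2 @^-1` outside (2 * r) = outside r.
    apply/seteqP; split => t; rewrite /outside /= enorm_scale_tuple//;
      by rewrite ltr_pM2l.
  rewrite -!ge0_integralZl//; last 2 first.
  - exact: measurable_L2_sqr.
  - exact: measurable_funTS.
  apply: ge0_le_integral => //.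
  - by move=> t _; rewrite mule_ge0// lee_fin exprn_ge0.
  - by apply: measurable_funeM; exact: measurable_funTS.
  - by apply: measurable_funeM; exact: measurable_L2_sqr.
  (* The substitution costs a factor [2 ^+ n], the hypothesis on [f] gains its square, and
     [2 ^+ n >= 2]. *)
  move=> t /= rt; rewrite -!EFinM lee_fin.
  have -> : row_of_tuple (scale_tuple 2 t) = 2 *: row_of_tuple t.
    by apply/rowP => i; rewrite !mxE tnth_mktuple.
  have := f2 _ rt; have := f_ge0 (2 *: row_of_tuple t).
  set u := f _; set w := f _ => u0 uw.
  have c2 : 2 <= 2 ^+ n :> R.
    by rewrite -[leLHS]expr1 ler_weXn2l// ler1n.
  have h : (2 ^+ n * u) ^+ 2 <= w ^+ 2.
    by rewrite lerXn2r ?nnegrE ?mulr_ge0 ?exprn_ge0 ?(le_trans _ uw) ?mulr_ge0 ?exprn_ge0.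
  rewrite -[leRHS]mulrC ler_pdivlMr//.
  apply: le_trans h; rewrite exprMn [leLHS]mulrAC ler_wpM2r ?sqr_ge0//.
  by rewrite expr2 ler_wpM2l// exprn_ge0.
move: IE; rewrite -(fineK Ifin) => IE.
have : (I <= (e ^+ 2 * ((2 * r) ^+ n * V))%:E + (2^-1)%:E * I)%E.
  by rewrite -{1}(fineK Ifin) IE leeD.
rewrite -(fineK Ifin) -EFinM -EFinD !lee_fin; lra.
Qed.

Lemma L2norm_le (r e : R) : (0 < n)%N -> 0 < r -> 0 <= e ->
  (forall x, f x <= 1) -> (forall x, r < enorm x -> f x <= e) ->
  (forall x, r < enorm x -> 2 ^+ n * f (2 *: x) <= f x) ->
  L2norm f ^+ 2 <= (1 + 2 ^+ n.+1 * e ^+ 2) * (r ^+ n * V).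
Proof.
move=> n0 r0 e0 f1 fe f2; rewrite -lee_fin L2norm_sqr.
have -> : [set: n.-tuple R] = eball n r `|` outside r.
  by rewrite outsideE setUv.
rewrite ge0_integral_setU//; last 3 first.
- exact: measurable_eball.
- exact: measurable_L2_sqr.
- by rewrite outsideE; apply/disj_set2P; rewrite setICr.
have -> : (1 + 2 ^+ n.+1 * e ^+ 2) * (r ^+ n * V) =
    r ^+ n * V + 2 * (e ^+ 2 * ((2 * r) ^+ n * V)).
  by rewrite exprMn exprS; ring.
rewrite EFinD leeD//; last exact: L2_outside_le.
rewrite -eball_volume// -[leRHS]mul1e -integral_cst; last exact: measurable_eball.
apply: ge0_le_integral => //.
- exact: measurable_eball.
- exact: measurable_L2_sqr.
- by move=> t _; rewrite lee_fin expr_le1.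
Qed.

End L2Bounds.

(** * Radial profile of a solution *)

Section Lines.
Variables (R : realType) (d : nat).
Implicit Types (f : 'rV[R]_d -> R) (x v : 'rV[R]_d).

Let line_quotient f x v (t : R) :
  (fun h : R => h^-1 *: (((fun s : R => f (s *: v + x)) \o shift t) (h *: 1) -
                         f (t *: v + x))) =
  (fun h : R => h^-1 *: ((f \o shift (t *: v + x)) (h *: v) - f (t *: v + x))).
Proof.
by apply/funext => h /=; rewrite [h *: 1]mulr1 scalerDl addrA.
Qed.

Lemma derive_line f x v (t : R) :
  'D_v f (t *: v + x) = 'D_1 (fun s : R => f (s *: v + x)) t.
Proof. by rewrite /derive line_quotient. Qed.

Lemma is_derive_line f x v (t : R) : differentiable f (t *: v + x) ->
  is_derive t 1 (fun s : R => f (s *: v + x)) ('D_v f (t *: v + x)).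
Proof.
move=> /diff_derivable df; rewrite derive_line; apply: derivableP.
by rewrite /derivable line_quotient; exact: df.
Qed.

Lemma enorm_delta (i j : 'I_d) (s r : R) : i != j ->
  enorm (s *: delta_mx ord0 i + r *: delta_mx ord0 j : 'rV[R]_d) =
  Num.sqrt (s ^+ 2 + r ^+ 2).
Proof.
move=> ij; rewrite /enorm (bigD1 i)//= (bigD1 j)/=; last by rewrite eq_sym.
rewrite !mxE !eqxx (negbTE ij) [j == i]eq_sym (negbTE ij) !mulr1 !mulr0 addr0 add0r.
rewrite big1 ?addr0// => k /andP[ki kj].
by rewrite !mxE (negbTE ki) (negbTE kj) !andbF !mulr0 addr0 expr0n.
Qed.

Lemma enorm_axis (j : 'I_d) (r : R) : enorm (r *: delta_mx ord0 j) = `|r|.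
Proof.
rewrite /enorm (bigD1 j)//= !mxE !eqxx mulr1 big1 ?addr0 ?sqrtr_sqr// => k kj.
by rewrite !mxE (negbTE kj) andbF mulr0 expr0n.
Qed.

End Lines.

Section RadialProfile.
Variables (R : realType) (d : nat) (alpha omega : R) (f : 'rV[R]_d -> R).
Hypotheses (alpha_gt0 : 0 < alpha) (hf : positive_solution alpha omega f).
Variable i0 : 'I_d.
Implicit Types (r s t : R) (x : 'rV[R]_d).

Local Notation e0 := (delta_mx ord0 i0 : 'rV[R]_d).

(** Taken along the whole axis, negative [r] included, so that it is differentiable at 0 and
    even. *)
Definition profile r := f (r *: e0).
Definition profile_derivative r := partial i0 f (r *: e0).
Local Notation p := profile.
Local Notation p' := profile_derivative.
(** The radial component of the flux under the divergence; the slope [q] is [- W / p]. *)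
Definition profile_flux r := p' r / (1 - p r `^ (2 * alpha)).
Local Notation W := profile_flux.

Lemma radial_profile x : f x = p (enorm x).
Proof.
have E : enorm (enorm x *: e0) = enorm x by rewrite enorm_axis ger0_norm// sqrtr_ge0.
have dec := solution_decreasing hf.
by apply/eqP; rewrite eq_le !dec// E.
Qed.

Let solution_differentiable x : differentiable f x.
Proof. by case: (solution_C2 hf) => -[]. Qed.

Let partial_differentiable i x : differentiable (partial i f) x.
Proof. by case: (solution_C2 hf) => _ /(_ i) -[]. Qed.

Lemma profile_is_derive r : is_derive r 1 p (p' r).
Proof.
have := @is_derive_line R d f 0 e0 r (solution_differentiable _).
by rewrite addr0; under eq_fun do rewrite addr0.
Qed.

Lemma profile_derivative_is_derive r :
  is_derive r 1 p' ('D_e0 (partial i0 f) (r *: e0)).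
Proof.
have := @is_derive_line R d (partial i0 f) 0 e0 r (partial_differentiable _ _).
by rewrite addr0; under eq_fun do rewrite addr0.
Qed.

Lemma profile_gt0 r : 0 < p r.
Proof. exact: (solution_gt0 hf). Qed.

Lemma profile_lt1 r : p r < 1.
Proof. exact: (solution_lt1 hf). Qed.

Lemma profile_pow_lt1 r : p r `^ (2 * alpha) < 1.
Proof.
have al2 : 0 < 2 * alpha by rewrite mulr_gt0.
have := gt0_ltr_powR al2 _ _ (profile_lt1 r).
by rewrite powR1; apply; rewrite nnegrE// ltW// profile_gt0.
Qed.

Lemma profile_even r : p (- r) = p r.
Proof. by rewrite [LHS]radial_profile [RHS]radial_profile !enorm_axis normrN. Qed.

Lemma profile_nonincreasing r s : 0 <= r -> r <= s -> p s <= p r.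
Proof.
move=> r0 rs; apply: (solution_decreasing hf).
by rewrite !enorm_axis !ger0_norm// (le_trans r0).
Qed.

Lemma profile_derivative0 : p' 0 = 0.
Proof.
have h1 := profile_is_derive 0.
have h2 : is_derive (0 : R) 1 p (- p' 0).
  have hN : is_derive (0 : R) 1 (fun s : R => - s) (- 1).
    by apply: is_derive1_opp; exact: is_derive_id.
  have hp : is_derive (- 0 : R) 1 p (p' 0) by rewrite oppr0.
  have := is_derive1_comp hp hN; rewrite mulrN1.
  by congr is_derive; apply/funext => s /=; rewrite profile_even.
by have := @derive_val _ _ _ _ _ _ _ h1; rewrite (@derive_val _ _ _ _ _ _ _ h2); lra.
Qed.

(** A positive [p' r] would stay positive just beyond [r], by continuity, and make [p] increase. *)
Lemma profile_derivative_le0 r : 0 < r -> p' r <= 0.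
Proof.
move=> r0; rewrite leNgt; apply/negP => P0.
have P2 : 0 < p' r / 2 by lra.
have [n n0 Hn] := is_derive1_dist (profile_derivative_is_derive r) P2.
have n2 : r <= r + n / 2 by rewrite lerDl divr_ge0 ?ltW.
pose F s := p s - p' r / 2 * s.
have : F r <= F (r + n / 2).
  apply: (@le_of_derive1_ge0 _ F (fun z => p' z - p' r / 2) _ _ n2) => z /andP[rx xn].
    have := is_derive1_sub (profile_is_derive z)
      (is_derive1_scale (p' r / 2) (is_derive_id z 1)).
    by move=> h; apply: (is_derive_eq h); rewrite mulr1.
  have /Hn : `|z - r| < n by rewrite ger0_norm; lra.
  by rewrite ltr_norml => /andP[+ _]; lra.
have := profile_nonincreasing (ltW r0) n2.
have : 0 < p' r / 2 * (n / 2) by rewrite mulr_gt0// divr_gt0.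
by rewrite /F; lra.
Qed.

Lemma profile_pow_is_derive r :
  is_derive r 1 (fun s : R => p s `^ (2 * alpha))
    (2 * alpha * p r `^ (2 * alpha - 1) * p' r).
Proof.
exact: (is_derive1_comp (is_derive1_powR _ (profile_gt0 r)) (profile_is_derive r)).
Qed.

Lemma profile_flux_derivable r : is_derive r 1 W ('D_1 W r).
Proof.
have y1 : 1 - p r `^ (2 * alpha) != 0.
  by rewrite subr_eq0 eq_sym lt_eqF// profile_pow_lt1.
have dy := is_derive1_sub (is_derive_cst (1 : R) r 1) (profile_pow_is_derive r).
have := is_derive1_mul (profile_derivative_is_derive r)
  (@is_derive1_inv _ (fun z : R => 1 - p z `^ (2 * alpha)) _ _ y1 dy).
by case=> dW _; exact: derivableP.
Qed.

(** The norm of [r e0 + t e_i] for a direction [e_i] orthogonal to [e0]. *)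
Let rho r t := Num.sqrt (t ^+ 2 + r ^+ 2).

Let rho_gt0 r t : 0 < r -> 0 < rho r t.
Proof.
by move=> r0; rewrite sqrtr_gt0 ltr_wpDl ?sqr_ge0// exprn_gt0.
Qed.

Let rho0 r : 0 < r -> rho r 0 = r.
Proof. by move=> r0; rewrite /rho expr0n add0r sqrtr_sqr gtr0_norm. Qed.

Let rho_is_derive r t : 0 < r -> is_derive t 1 (rho r) (t / rho r t).
Proof.
move=> r0; have rt0 : 0 < t ^+ 2 + r ^+ 2 by rewrite -sqrtr_gt0; exact: rho_gt0.
have dt := is_derive1_add (is_derive1_sqr (is_derive_id t (1 : R)))
  (is_derive_cst (r ^+ 2) t 1).
apply: (is_derive_eq (@is_derive1_comp _ Num.sqrt (fun s : R => s ^+ 2 + r ^+ 2)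
  t _ _ (is_derive1_sqrt rt0) dt)).
by rewrite -/(rho r t); field; rewrite gt_eqF// rho_gt0.
Qed.

Lemma partial_side i r t : i != i0 -> 0 < r ->
  partial i f (t *: delta_mx ord0 i + r *: e0) = p' (rho r t) * (t / rho r t).
Proof.
move=> ii0 r0; rewrite /partial derive_line.
have -> : (fun s : R => f (s *: delta_mx ord0 i + r *: e0)) = p \o rho r.
  by apply/funext => s /=; rewrite radial_profile enorm_delta.
have h := is_derive1_comp (profile_is_derive (rho r t)) (rho_is_derive t r0).
exact: (@derive_val _ _ _ _ _ _ _ h).
Qed.

Let flux i x := partial i f x / (1 - `|f x| `^ (2 * alpha)).

Lemma flux_axis r : partial i0 (flux i0) (r *: e0) = 'D_1 W r.
Proof.
have E : (fun s : R => flux i0 (s *: e0 + 0)) = W.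
  apply/funext => s; rewrite addr0 /flux /W.
  by rewrite ger0_norm// ltW// profile_gt0.
by have := @derive_line R d (flux i0) 0 e0 r; rewrite addr0 /partial E.
Qed.

(** Along a transverse line the flux is [s * (W (rho s) / rho s)], whose derivative at [s = 0] is
    the second factor there. The [d - 1] such directions produce the friction term. *)
Lemma flux_side i r : i != i0 -> 0 < r -> partial i (flux i) (r *: e0) = W r / r.
Proof.
move=> ii0 r0.
have := @derive_line R d (flux i) (r *: e0) (delta_mx ord0 i) 0.
rewrite scale0r add0r /partial => ->.
have -> : (fun s : R => flux i (s *: delta_mx ord0 i + r *: e0)) =
    (fun s : R => s * (W (rho r s) * (rho r s)^-1)).
  apply/funext => s; rewrite /flux partial_side// /W radial_profile enorm_delta//.
  by rewrite ger0_norm ?(ltW (profile_gt0 _))// -/(rho r s); ring.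
have rn0 : rho r 0 != 0 by rewrite gt_eqF// rho_gt0.
have h1 := is_derive1_comp (profile_flux_derivable (rho r 0)) (rho_is_derive 0 r0).
have h2 := is_derive1_inv rn0 (rho_is_derive 0 r0).
have h := is_derive1_mul (is_derive_id (0 : R) (1 : R)) (is_derive1_mul h1 h2).
rewrite (@derive_val _ _ _ _ _ _ _ h) mul0r addr0 mul1r /=.
by rewrite rho0.
Qed.

Lemma divergence_flux r : 0 < r ->
  divergence flux (r *: e0) = 'D_1 W r + d.-1%:R * (W r / r).
Proof.
move=> r0; rewrite /divergence (bigD1 i0)//= flux_axis; congr (_ + _).
rewrite (eq_bigr (fun=> W r / r)); last by move=> i ii0; exact: flux_side.
by rewrite sumr_const cardC1 card_ord mulr_natl.
Qed.

Lemma grad_sqnorm_axis r : 0 < r -> grad_sqnorm f (r *: e0) = p' r ^+ 2.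
Proof.
move=> r0; rewrite /grad_sqnorm (bigD1 i0)//= big1 ?addr0// => i ii0.
have := partial_side 0 ii0 r0; rewrite scale0r add0r => ->.
by rewrite mul0r mulr0 expr0n.
Qed.

Lemma profile_equation r : 0 < r ->
  'D_1 W r = omega * p r - p r `^ (2 * alpha) * p r
    + alpha * p r `^ (2 * alpha) * W r ^+ 2 / p r - d.-1%:R * (W r / r).
Proof.
move=> r0; have := solution_eq hf (r *: e0).
rewrite -/(divergence flux _) divergence_flux// grad_sqnorm_axis// -/(p r).
have p0 := profile_gt0 r.
rewrite (ger0_norm (ltW p0)).
have -> : p' r ^+ 2 / (1 - p r `^ (2 * alpha)) ^+ 2 = W r ^+ 2.
  by rewrite /W expr_div_n.
have -> : p r `^ (2 * alpha - 2) = p r `^ (2 * alpha) / p r ^+ 2.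
  by rewrite powRB ?(gt_eqF p0) ?implybT// powR_mulrn// ltW.
move=> h.
have -> : alpha * p r `^ (2 * alpha) * W r ^+ 2 / p r =
    alpha * (p r `^ (2 * alpha) / p r ^+ 2) * W r ^+ 2 * p r.
  by field; rewrite gt_eqF.
by lra.
Qed.

Lemma profile_droplet :
  droplet d.-1%:R alpha (omega_star alpha - omega) p (fun r => - W r / p r).
Proof.
have pn0 r : p r != 0 by rewrite gt_eqF// profile_gt0.
have yn0 r : 1 - p r `^ (2 * alpha) != 0.
  by rewrite subr_eq0 eq_sym lt_eqF// profile_pow_lt1.
split.
- by move=> r _; exact: profile_gt0.
- by move=> r _; exact: profile_lt1.
- move=> r r0; rewrite divr_ge0 ?(ltW (profile_gt0 r))// oppr_ge0.
  rewrite mulr_le0_ge0 ?profile_derivative_le0// invr_ge0 subr_ge0 ltW//.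
  exact: profile_pow_lt1.
- move=> r r0; apply: (is_derive_eq (profile_is_derive r)).
  by rewrite /W; field; rewrite pn0 yn0.
- move=> r r0.
  have h := is_derive1_mul (is_derive1_opp (profile_flux_derivable r))
    (is_derive1_inv (pn0 r) (profile_is_derive r)).
  apply: (is_derive_eq h); rewrite profile_equation//.
  have -> : p' r = W r * (1 - p r `^ (2 * alpha)) by rewrite /W divfK.
  have al1 : 1 + alpha != 0 by rewrite gt_eqF// addr_gt0.
  (* As [omega_star (1 + alpha) = 1], [y - omega] equals
     [- omega_star (1 - (1 + alpha) y) + del]. *)
  by rewrite /omega_star; field; rewrite pn0 al1 gt_eqF.
- move=> e e0'; have [r hr] := solution_vanishes hf e0'.
  exists (Num.max 1 (r + 1)); first by rewrite lt_max ltr01.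
  move=> s; rewrite ge_max => /andP[s1 rs].
  have s0 : 0 < s by apply: lt_le_trans s1.
  have := hr (s *: e0); rewrite enorm_axis (gtr0_norm s0) -/(p s).
  rewrite (ger0_norm (ltW (profile_gt0 s))); apply.
  by apply: lt_le_trans rs; rewrite ltrDl.
(* The quotient [- W / p] is continuous at 0 and vanishes there, because [p' 0 = 0]. *)
- move=> e e0'.
  have h := is_derive1_mul (is_derive1_opp (profile_flux_derivable 0))
    (is_derive1_inv (pn0 0) (profile_is_derive 0)).
  have [n n0 hn] := is_derive1_dist h e0'.
  exists (n / 2); first by rewrite divr_gt0.
  move=> r /andP[r0 rn].
  have /hn : `|r - 0| < n by rewrite subr0 gtr0_norm//; lra.
  rewrite {2}/W profile_derivative0 mul0r oppr0 mul0r subr0.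
  by move=> /ltr_normlW.
Qed.

End RadialProfile.

(** * Asymptotics of the mass *)

Section Concentration.
Variables (R : realType) (d : nat) (alpha : R).
Hypotheses (hd : (2 <= d)%N) (alpha_gt0 : 0 < alpha).

Local Notation ws := (omega_star alpha).
Local Notation L := (d.-1%:R * Num.sqrt ws).
Local Notation V := (unit_ball_volume R d).

(** The right-hand side is the chord over [[0, 1]] of a convex function. *)
Lemma expr1D_le (e : R) n : 0 <= e <= 1 -> (1 + e) ^+ n <= 1 + (2 ^+ n - 1) * e.
Proof.
move=> /andP[e0 e1]; elim: n => [|n IH]; first by rewrite !expr0 subrr mul0r addr0.
have h0 : 0 <= 1 + e by lra.
have c0 : 0 <= 2 ^+ n - 1 :> R by rewrite subr_ge0 exprn_ege1// ler1n.
have h1 : e * e <= e by rewrite ler_piMl.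
have := ler_wpM2l c0 h1; have := ler_wpM2l h0 IH.
by rewrite !exprS; lra.
Qed.

Lemma expr1B_ge (e : R) n : 0 <= e <= 1 -> 1 - n%:R * e <= (1 - e) ^+ n.
Proof.
move=> /andP[e0 e1]; elim: n => [|n IH]; first by rewrite expr0 mul0r subr0.
have h0 : 0 <= 1 - e by lra.
have h1 : 0 <= n%:R * (e * e) by rewrite mulr_ge0// mulr_ge0.
have := ler_wpM2l h0 IH.
by rewrite exprS -natr1; lra.
Qed.

(** The ball of radius [r1], where [f >= 1 - e], gives the lower bound: [d] factors [1 - e] come
    from the radius and two from the squared value. The ball of radius [r2] and the tail beyond it
    give the upper bound. *)
Lemma mass_bounds (e : R) : 0 < e < 1 -> exists2 d0 : R, 0 < d0 &
  forall omega (f : 'rV[R]_d -> R), 0 < omega < ws -> ws - omega <= d0 ->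
    positive_solution alpha omega f ->
    [/\ (1 - e) ^+ d.+2 * (L ^+ d * V) <= (ws - omega) ^+ d * L2norm f ^+ 2,
        (ws - omega) ^+ d * L2norm f ^+ 2 <=
          (1 + 2 ^+ d.+1 * e ^+ 2) * (1 + e) ^+ d * (L ^+ d * V) &
        forall x, (ws - omega) * enorm x <= L * (1 - e) -> 1 - e <= f x].
Proof.
move=> e01; have /andP[e0 e1] := e01.
have d0 : (0 < d)%N by apply: leq_trans hd.
have N0 : 0 < d.-1%:R :> R by rewrite ltr0n -subn1 subn_gt0.
have a0 : 0 < Num.sqrt ws := sqrt_omega_star_gt0 alpha_gt0.
have L0 : 0 < L by rewrite mulr_gt0.
have V0 := unit_ball_volume_ge0 R d.
have [del0 del00 H] := droplet_asymptotics N0 alpha_gt0 e01 (ler0n R d).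
exists del0 => // omega f /andP[om0 omw] oml hf.
pose i0 : 'I_d := Ordinal d0.
have hP := profile_droplet alpha_gt0 hf i0.
have del_gt0 : 0 < ws - omega by rewrite subr_gt0.
have [r1 [r2 [[r10 r12] [p1 p2] lo up tl]]] := H _ _ _ del_gt0 oml hP.
have r20 := lt_le_trans r10 r12.
have rad := radial_profile hf i0.
have f0 x : 0 <= f x by rewrite ltW// (solution_gt0 hf).
have L2f : L2 f by case: (solution_H1 hf).
have core x : enorm x <= r1 -> 1 - e <= f x.
  move=> xr; apply: (le_trans p1); rewrite rad.
  by apply: (profile_nonincreasing hf) => //; exact: sqrtr_ge0.
have deld : 0 <= (ws - omega) ^+ d by rewrite exprn_ge0// ltW.
split.
- have e10 : 0 <= 1 - e by lra.
  have := L2norm_ge L2f f0 r10 e10 core.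
  move=> /(ler_wpM2l deld); apply: le_trans.
  have -> : (ws - omega) ^+ d * ((1 - e) ^+ 2 * (r1 ^+ d * V)) =
    (1 - e) ^+ 2 * (((ws - omega) * r1) ^+ d * V) by rewrite exprMn; ring.
  have -> : (1 - e) ^+ d.+2 * (L ^+ d * V) =
    (1 - e) ^+ 2 * ((L * (1 - e)) ^+ d * V).
    by rewrite !exprMn -addn2 exprD; ring.
  rewrite ler_wpM2l ?sqr_ge0// ler_wpM2r//.
  by apply: lerXn2r => //; rewrite nnegrE mulr_ge0// ltW.
- have outer x : r2 < enorm x -> f x <= e.
    move=> xr; apply: le_trans p2; rewrite rad.
    by apply: (profile_nonincreasing hf); exact: ltW.
  have tail x : r2 < enorm x -> 2 ^+ d * f (2 *: x) <= f x.
    move=> xr; have x0 : 0 < enorm x := lt_trans r20 xr.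
    have x2 : enorm x <= 2 * enorm x by rewrite ler_peMl ?ler1n// ltW.
    have E2 : enorm (2 *: x) = 2 * enorm x.
      rewrite /enorm (eq_bigr (fun i => 2 ^+ 2 * x ord0 i ^+ 2)); last first.
        by move=> i _; rewrite mxE exprMn.
      by rewrite -mulr_sumr sqrtrM ?sqr_ge0// sqrtr_sqr ger0_norm.
    have dE : d = d.-1.+1 by rewrite prednK.
    have tl' r : enorm x <= r -> d.-1.+1%:R <= (1 - profile f i0 r `^ (2 * alpha)) *
        (- profile_flux alpha f i0 r / profile f i0 r) * r.
      by rewrite -dE => xr'; apply: tl; rewrite (le_trans (ltW xr)).
    (* Used with exponent [d] between [enorm x] and [2 * enorm x]; the common factor [enorm x ^+ d]
       is then cancelled. *)
    have := droplet_tail hP x0 tl' x2.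
    rewrite -dE exprMn mulrA ler_pM2r ?exprn_gt0//.
    by rewrite !rad E2 mulrC.
  have f1 x : f x <= 1 by rewrite ltW// (solution_lt1 hf).
  have := L2norm_le L2f f0 d0 r20 (ltW e0) f1 outer tail.
  move=> /(ler_wpM2l deld) h; apply: (le_trans h).
  have -> : (ws - omega) ^+ d * ((1 + 2 ^+ d.+1 * e ^+ 2) * (r2 ^+ d * V)) =
    (1 + 2 ^+ d.+1 * e ^+ 2) * (((ws - omega) * r2) ^+ d * V).
    by rewrite exprMn; ring.
  have -> : (1 + 2 ^+ d.+1 * e ^+ 2) * (1 + e) ^+ d * (L ^+ d * V) =
    (1 + 2 ^+ d.+1 * e ^+ 2) * ((L * (1 + e)) ^+ d * V).
    by rewrite !exprMn; ring.
  rewrite ler_wpM2l//.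
    by rewrite addr_ge0// mulr_ge0 ?sqr_ge0// exprn_ge0.
  rewrite ler_wpM2r//; apply: lerXn2r => //; rewrite nnegrE.
    by rewrite mulr_ge0// ltW.
  by rewrite mulr_ge0 ?(ltW L0)// addr_ge0// ltW.
- move=> x hx; apply: core.
  by rewrite -(ler_pM2l del_gt0); apply: le_trans lo.
Qed.

Lemma mass_asymptotics (eps : R) : 0 < eps -> exists2 d0 : R, 0 < d0 &
  forall omega (f : 'rV[R]_d -> R), 0 < omega < ws -> ws - omega <= d0 ->
    positive_solution alpha omega f ->
    `|(ws - omega) ^+ d * L2norm f ^+ 2 - L ^+ d * V| <= eps.
Proof.
move=> eps0; pose K := L ^+ d * V.
have K0 : 0 <= K.
  by rewrite mulr_ge0 ?unit_ball_volume_ge0// exprn_ge0// mulr_ge0// sqrtr_ge0.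
(* [d.+2] comes from Bernoulli's inequality, the rest from expanding
   [(1 + 2 ^+ d.+1 * e) * (1 + 2 ^+ d * e)] with [e * e <= e]. *)
pose C : R := d.+2%:R + (2 ^+ d.+1 + 2 ^+ d + 2 ^+ d.+1 * 2 ^+ d).
have p2 n : 0 <= 2 ^+ n :> R by rewrite exprn_ge0.
have C0' := addr_ge0 (addr_ge0 (p2 d.+1) (p2 d)) (mulr_ge0 (p2 d.+1) (p2 d)).
have C0 : 0 <= C := addr_ge0 (ler0n R d.+2) C0'.
have KC0 : 0 < K * C + 1 by rewrite ltr_wpDl// mulr_ge0.
pose e := Num.min (1 / 2) (eps / (K * C + 1)).
have e0 : 0 < e by rewrite lt_min divr_gt0//= divr_gt0.
have e1 : e <= 1 / 2 by rewrite ge_min lexx.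
have e01 : 0 < e < 1 by rewrite e0/=; lra.
have e01' : 0 <= e <= 1 by rewrite ltW//=; lra.
have Ke : K * C * e <= eps.
  have : e * (K * C + 1) <= eps by rewrite -ler_pdivlMr// ge_min lexx orbT.
  by lra.
have [d0 d00 H] := mass_bounds e01; exists d0 => // omega f ow ol hf.
have [lo up _] := H _ _ ow ol hf; rewrite -/K in lo up *.
have lo' : 1 - C * e <= (1 - e) ^+ d.+2.
  apply: le_trans (expr1B_ge d.+2 e01').
  rewrite lerD2l lerN2 ler_wpM2r ?(ltW e0)// lerDl.
  exact: C0'.
have up' : (1 + 2 ^+ d.+1 * e ^+ 2) * (1 + e) ^+ d <= 1 + C * e.
  have h1 : 1 + 2 ^+ d.+1 * e ^+ 2 <= 1 + 2 ^+ d.+1 * e.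
    by rewrite lerD2l ler_wpM2l// expr2 ler_piMl ?(ltW e0)//; lra.
  have h2 : (1 + e) ^+ d <= 1 + 2 ^+ d * e.
    by apply: (le_trans (expr1D_le d e01')); rewrite lerD2l ler_wpM2r ?(ltW e0)//; lra.
  have h3 : (1 + 2 ^+ d.+1 * e ^+ 2) * (1 + e) ^+ d <=
      (1 + 2 ^+ d.+1 * e) * (1 + 2 ^+ d * e).
    apply: ler_pM => //; first by rewrite addr_ge0// mulr_ge0// sqr_ge0.
    by rewrite exprn_ge0// addr_ge0// ltW.
  apply: (le_trans h3).
  have h4 : 2 ^+ d.+1 * 2 ^+ d * (e * e) <= 2 ^+ d.+1 * 2 ^+ d * e.
    by rewrite ler_wpM2l ?mulr_ge0// ler_piMl ?(ltW e0)//; lra.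
  have h5 : 0 <= d.+2%:R * e by rewrite mulr_ge0// ltW.
  by rewrite /C; lra.
have lo2 : (1 - C * e) * K <= (1 - e) ^+ d.+2 * K := ler_wpM2r K0 lo'.
have up2 : (1 + 2 ^+ d.+1 * e ^+ 2) * (1 + e) ^+ d * K <= (1 + C * e) * K.
  exact: (ler_wpM2r K0 up').
rewrite ler_norml; apply/andP; split; lra.
Qed.

Lemma enorm_continuous : continuous (@enorm R d).
Proof.
suff H (s : seq 'I_d) : continuous (fun x : 'rV[R]_d => \sum_(i <- s) x ord0 i ^+ 2).
  by move=> x; exact: (continuous_comp (H (index_enum _) x) (@sqrt_continuous R _)).
elim: s => [|i s IH].
  have -> : (fun x : 'rV[R]_d => \sum_(i <- [::]) x ord0 i ^+ 2) = cst 0.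
    by apply/funext => x; rewrite big_nil.
  exact: cst_continuous.
have -> : (fun x : 'rV[R]_d => \sum_(j <- i :: s) x ord0 j ^+ 2) =
    (fun x => x ord0 i ^+ 2 + \sum_(j <- s) x ord0 j ^+ 2).
  by apply/funext => x; rewrite big_cons.
move=> x; have c := @coord_continuous R 1 d ord0 i.
have c2 : {for x, continuous (fun y : 'rV[R]_d => y ord0 i ^+ 2)}.
  apply: (@continuous_comp _ _ _ (fun y : 'rV[R]_d => y ord0 i)
    (fun z : R => z ^+ 2) x); [exact: c|exact: exprn_continuous].
exact: (cvgD c2 (IH x)).
Qed.

Lemma compact_enorm_bounded (A : set 'rV[R]_d) : compact A ->
  exists r : R, forall x, A x -> enorm x <= r.
Proof.
move=> cA; have [->|/set0P A0] := eqVneq A set0; first by exists 0.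
have [|c _ hc] := @EVT_max_rV R d (@enorm R d) A A0 cA.
  by apply: continuous_subspaceT; exact: enorm_continuous.
by exists (enorm c) => x Ax; apply: hc; rewrite inE.
Qed.

Lemma near_omega_star (d0 : R) : 0 < d0 ->
  \forall omega \near ws^'-, 0 < omega < ws /\ ws - omega <= d0.
Proof.
move=> d00; have ws0 := omega_star_gt0 alpha_gt0.
near=> omega; split.
  by apply/andP; split; near: omega; [exact: nbhs_left_gt|exact: nbhs_left_lt].
rewrite lerBlDr -lerBlDl; near: omega; apply: nbhs_left_ge.
by rewrite ltrBlDr ltrDl.
Unshelve. all: by end_near. Qed.

End Concentration.

Theorem theorem1p2 (R : realType) (d : nat) (alpha : R)
    (hd : (2 <= d)%N) (halpha : 0 < alpha) :
  exists K : R,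
  forall phi : R -> 'rV[R]_d -> R,
    (forall omega : R, 0 < omega < omega_star alpha ->
       positive_solution alpha omega (phi omega)) ->
    (forall A : set 'rV[R]_d, compact A ->
       {uniform A, phi @ (omega_star alpha)^'- --> (cst 1 : 'rV[R]_d -> R)}) /\
    (forall omega : R,
       L2norm (phi omega) ^+ 2 =
         K / (omega_star alpha - omega) ^+ d
         +o_(omega \near (omega_star alpha)^'-)
         (1 / (omega_star alpha - omega) ^+ d)).
Proof.
set L := d.-1%:R * Num.sqrt (omega_star alpha).
have L0 : 0 < L.
  by rewrite mulr_gt0 ?sqrt_omega_star_gt0// ltr0n -subn1 subn_gt0.
exists (L ^+ d * unit_ball_volume R d) => phi hphi; split.
- move=> A cA P /uniform_nbhs[E [entE EP]].
  move: entE; rewrite -entourage_ballE => -[eps /= eps0 Eeps].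
  pose e := Num.min (1 / 2) (eps / 2).
  have e12 : e <= 1 / 2 by rewrite ge_min lexx.
  have ee : e <= eps / 2 by rewrite ge_min lexx orbT.
  have e0 : 0 < e by rewrite lt_min divr_gt0//= divr_gt0.
  have e01 : 0 < e < 1 by rewrite e0/=; lra.
  have [r hr] := compact_enorm_bounded cA.
  have [d1 d10 H] := mass_bounds hd halpha e01.
  have r0 : 0 < `|r| + 1 by rewrite ltr_wpDl.
  have L1 : 0 < L * (1 - e) by rewrite mulr_gt0//; lra.
  (* The second threshold makes the core, of radius [L (1 - e) / del], contain the ball of radius
     [r] that encloses [A]. *)
  have d20 : 0 < Num.min d1 (L * (1 - e) / (`|r| + 1)).
    by rewrite lt_min d10 divr_gt0.
  apply: filterS (near_omega_star halpha d20) => omega [ow].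
  rewrite le_min => /andP[ol1 ol2]; apply: EP => x Ax; apply: Eeps.
  have [_ _ core] := H _ _ ow ol1 (hphi _ ow).
  have ow' : 0 <= omega_star alpha - omega by rewrite subr_ge0 ltW//; case/andP: ow.
  have xr : (omega_star alpha - omega) * enorm x <= L * (1 - e).
    move: ol2; rewrite ler_pdivlMr//; apply: le_trans.
    rewrite ler_wpM2l// (le_trans (hr _ Ax))// (le_trans (ler_norm r))//.
    by rewrite lerDl.
  have := core _ xr; have := solution_lt1 (hphi _ ow) x.
  by rewrite /ball /= => h1 h2; rewrite ger0_norm; lra.
(* The pointwise little-o statement is an instance of an equality of functions, to which [eqaddoP]
   applies. *)
- suff h : (fun omega => L2norm (phi omega) ^+ 2) =
      (fun omega => L ^+ d * unit_ball_volume R d / (omega_star alpha - omega) ^+ d)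
      +o_ ((omega_star alpha)^'-) (fun omega => 1 / (omega_star alpha - omega) ^+ d).
    by move=> omega; exact: (congr1 (fun g => g omega) h).
  apply/eqaddoP => eps eps0.
  have [d1 d10 H] := mass_asymptotics hd halpha eps0.
  apply: filterS (near_omega_star halpha d10) => omega [ow ol].
  have del0 : 0 < omega_star alpha - omega by rewrite subr_gt0; case/andP: ow.
  have deld : 0 < (omega_star alpha - omega) ^+ d by rewrite exprn_gt0.
  have := H _ _ ow ol (hphi _ ow); rewrite -/L => h.
  rewrite [leRHS](_ : _ = eps / (omega_star alpha - omega) ^+ d); last first.
    by rewrite mul1r gtr0_norm ?invr_gt0.
  rewrite ler_pdivlMr// -[X in _ * X]gtr0_norm// -normrM; apply: le_trans h.
  rewrite le_eqVlt; apply/orP; left; apply/eqP; congr (`|_|).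
  rewrite -[(_ - _) omega]/(_ omega - _ omega) /=.
  set D := _ ^+ d in deld *; set M := L2norm _ ^+ 2.
  by field; rewrite gt_eqF.
Qed.
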